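(* Let $U$ be a $\mathbf{B}_1$-module and $V$ a $\mathbf{B}_r$-module with $V(\emptyset)=\{0\}$. Then $\mathrm{ch}(U\circ V)=\mathrm{ch}(U)\circ\mathrm{ch}(V)$, where $\circ$ on the right is the plethysm $\mathbb{A}(1)\times\mathbb{A}(r)_+\to\mathbb{A}(r)$. Consequently, if $A$ is a species and $B$ an $r$-species with $B(\emptyset)=\emptyset$, then $Z_{A\circ B}=Z_A\circ Z_B$.
   Context: $\mu_r$, $W(r,n)=\mu_r\wr S_n$, $\mathbf{B}_r$ = category of finite sets with free $\mu_r$-action and equivariant bijections ($\mathbf{B}_1$ = finite sets and bijections), $[n]_r=\mu_r\times\{1,\dots,n\}$. A $\mathbf{B}_r$-module is a functor $\mathbf{B}_r\to$ finite-dimensional complex vector spaces; its characteristic is $\mathrm{ch}(U)=\sum_n\frac{1}{r^nn!}\sum_{w\in W(r,n)}\mathrm{tr}(w,U([n]_r))p_w\in\mathbb{A}(r)=\mathbb{C}[[p_i(\zeta)]]$, with $p_w=\prod p_i(\zeta)^{a_i(\zeta)}$ ($a_i(\zeta)$ = number of cycles of length $i$ and type $\zeta$). An $r$-species is a functor $A:\mathbf{B}_r\to\mathbf{B}_1$, with cycle index $Z_A=\mathrm{ch}(\mathbb{C}^{A(-)})$. For a $\mathbf{B}_1$-module $U$ and $\mathbf{B}_r$-module $V$, $(U\circ V)(I)=\bigoplus_{\pi}\bigl(U(\pi)\otimes\bigotimes_{J\in\pi}V(J)\bigr)$, summed over partitions $\pi$ of $I$ into nonempty blocks each of which is $\mu_r$-stable;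 similarly $(A\circ B)(I)=\coprod_\pi A(\pi)\times\prod_{J\in\pi}B(J)$. Here the plethysm $\circ:\mathbb{A}(1)\times\mathbb{A}(r)_+\to\mathbb{A}(r)$ is the unique operation such that $f\mapsto f\circ g$ is a continuous algebra homomorphism, $g\mapsto p_i\circ g$ is a continuous algebra homomorphism, and $p_i\circ p_j(\zeta)=p_{ij}(\zeta)$. *)

(* Defs.v *)
From HB Require Import structures.
From mathcomp Require Import all_boot all_order all_algebra all_fingroup.
Set Implicit Arguments. Unset Strict Implicit. Unset Printing Implicit Defensive.
Import GRing.Theory Num.Theory.
Local Open Scope ring_scope.

(* mu_r, modelled as the cyclic group Z/r (additive), for r > 0. *)
Notation mu r := 'I_(r.-1).+1.

Record obj (r : nat) := Obj { car :> finType; act : car -> mu r -> car }.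
Arguments Obj {r} car act.
Arguments act {r} _ _ _.

Definition is_obj r (I : obj r) : Prop :=
  [/\ forall x, act I x 0 = x,
      forall x z1 z2, act I (act I x z1) z2 = act I x (z1 + z2)
    & forall x z, act I x z = x -> z = 0].

Definition is_hom r (I J : obj r) (f : I -> J) : Prop :=
  bijective f /\ forall x z, f (act I x z) = act J (f x) z.

(* A finite-dimensional vector space is given by a finite basis bas I
   (i.e. U(I) = C^(bas I)); U(f) is given by its matrix:
   mor f x y = coefficient of the basis vector y in U(f)(x). *)
Record rmod (C : Type) (r : nat) := RMod {
  bas : obj r -> finType;
  mor : forall I J : obj r, (I -> J) -> bas I -> bas J -> C }.
Arguments RMod {C r} bas mor.
Arguments bas {C r} _ _.
Arguments mor {C r} _ {I J} _ _ _.

Definition is_mod (C : numClosedFieldType) r (U : rmod C r) : Prop :=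
  (forall I : obj r, is_obj I ->
     forall x y, mor U (fun v : I => v) x y = (x == y)%:R) /\
  (forall (I J K : obj r) (f : I -> J) (g : J -> K),
     is_obj I -> is_obj J -> is_obj K -> is_hom f -> is_hom g ->
     forall x z, mor U (g \o f) x z = \sum_y mor U f x y * mor U g y z).

(* ---------- r-species (functors B_r -> B_1), given by graphs ---------- *)
Record rsp (r : nat) := RSp {
  spo : obj r -> finType;
  spm : forall I J : obj r, (I -> J) -> spo I -> spo J -> bool }.
Arguments RSp {r} spo spm.
Arguments spo {r} _ _.
Arguments spm {r} _ {I J} _ _ _.

Definition is_sp r (A : rsp r) : Prop :=
  (forall (I J : obj r) (f : I -> J), is_obj I -> is_obj J -> is_hom f ->
     forall x, exists! y, spm A f x y) /\
  (forall I : obj r, is_obj I -> forall x y, spm A (fun v : I => v) x y = (x == y)) /\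
  (forall (I J K : obj r) (f : I -> J) (g : J -> K),
     is_obj I -> is_obj J -> is_obj K -> is_hom f -> is_hom g ->
     forall x z, spm A (g \o f) x z = [exists y, spm A f x y && spm A g y z]).

Definition lin (C : numClosedFieldType) r (A : rsp r) : rmod C r :=
  RMod (spo A) (fun I J f x y => (spm A f x y)%:R).

Definition stable r (I : obj r) (B : {set I}) : bool :=
  [forall x in B, forall z, act I x z \in B].

Definition rpart r (I : obj r) (P : {set {set I}}) : bool :=
  [&& partition P [set: I], set0 \notin P & [forall B in P, stable B]].

Definition parts r (I : obj r) := {P : {set {set I}} | rpart P}.
Definition blk (T : finType) (P : {set {set T}}) := {B : {set T} | B \in P}.

Definition bobj (T : finType) (P : {set {set T}}) : obj 1 :=
  Obj (blk P) (fun B _ => B).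

Definition sobj r (I : obj r) (B : {set I}) : obj r :=
  Obj {x : I | x \in B} (fun x z => insubd x (act I (val x) z)).

Definition bmap (T T' : finType) (f : T -> T') (P : {set {set T}})
    (Q : {set {set T'}}) (h : [forall B : blk P, f @: val B \in Q]) :
    blk P -> blk Q :=
  fun B => exist _ (f @: val B) (elimT forallP h B).

Definition restr (T T' : finType) (f : T -> T') (A : {set T}) :
    {x | x \in A} -> {y | y \in f @: A} :=
  fun x => exist _ (f (val x)) (imset_f f (valP x)).

Definition cbas (C : Type) r (U : rmod C 1) (V : rmod C r) (I : obj r) : finType :=
  {P : parts I &
     (bas U (bobj (val P)) *
      {dffun forall B : blk (val P), bas V (sobj (val B))})%type}.

Definition cmor (C : numClosedFieldType) r (U : rmod C 1) (V : rmod C r)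
    (I J : obj r) (f : I -> J) (s : cbas U V I) (t : cbas U V J) : C :=
  let: existT P (u, v) := s in
  let: existT Q (u', v') := t in
  match @idP [forall B : blk (val P), f @: val B \in val Q] with
  | ReflectT h =>
      mor U (I := bobj (val P)) (J := bobj (val Q)) (bmap h) u u' *
      \prod_(B : blk (val P))
         mor V (I := sobj (val B)) (J := sobj (f @: val B))
             (@restr I J f (val B)) (v B) (v' (bmap h B))
  | ReflectF _ => 0
  end.

Definition mcomp (C : numClosedFieldType) r (U : rmod C 1) (V : rmod C r) : rmod C r :=
  RMod (cbas U V) (@cmor C r U V).

Definition csp_o r (A : rsp 1) (B : rsp r) (I : obj r) : finType :=
  {P : parts I &
     (spo A (bobj (val P)) *
      {dffun forall Bk : blk (val P), spo B (sobj (val Bk))})%type}.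

Definition csp_m r (A : rsp 1) (B : rsp r)
    (I J : obj r) (f : I -> J) (s : csp_o A B I) (t : csp_o A B J) : bool :=
  let: existT P (u, v) := s in
  let: existT Q (u', v') := t in
  match @idP [forall Bk : blk (val P), f @: val Bk \in val Q] with
  | ReflectT h =>
      spm A (I := bobj (val P)) (J := bobj (val Q)) (bmap h) u u' &&
      [forall Bk : blk (val P),
         spm B (I := sobj (val Bk)) (J := sobj (f @: val Bk))
             (@restr I J f (val Bk)) (v Bk) (v' (bmap h Bk))]
  | ReflectF _ => false
  end.

Definition spcomp r (A : rsp 1) (B : rsp r) : rsp r := RSp (csp_o A B) (@csp_m r A B).

(* A monomial of weight n: exponents a (j, zeta) of p_(j+1)(zeta), j < n.
   (Every monomial of weight n is uniquely of this form.) *)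
Definition Mono r n := {ffun 'I_n * mu r -> 'I_n.+1}.
Definition mweight r n (a : Mono r n) : nat := (\sum_(x : 'I_n * mu r) x.1.+1 * a x)%N.

(* A formal series, through its homogeneous components: s n a is the
   coefficient of the monomial a when mweight a = n. *)
Definition series (C : Type) r := forall n, Mono r n -> C.
Definition series_eq (C : Type) r (s t : series C r) : Prop :=
  forall n (a : Mono r n), mweight a = n -> s n a = t n a.

Definition nobj r n : obj r := Obj (mu r * 'I_n)%type (fun x z => (x.1 + z, x.2)).

(* W(r,n) = mu_r wr S_n = equivariant permutations of [n]_r *)
Definition Wrn r n : {set {perm (mu r * 'I_n)}} :=
  [set w : {perm (mu r * 'I_n)} | [forall x : mu r * 'I_n, forall z : mu r,
              w (x.1 + z, x.2) == ((w x).1 + z, (w x).2)]].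

Definition wsig r n (w : {perm (mu r * 'I_n)}) (k : 'I_n) : 'I_n := (w (0, k)).2.
Definition wlen r n (w : {perm (mu r * 'I_n)}) (k : 'I_n) : nat := fingraph.order (wsig w) k.
Definition wtyp r n (w : {perm (mu r * 'I_n)}) (k : 'I_n) : mu r :=
  (iter (wlen w k) w (0, k)).1.

(* p_w : a_i(zeta) = number of cycles of length i and type zeta *)
Definition wmono r n (w : {perm (mu r * 'I_n)}) : Mono r n :=
  [ffun x : 'I_n * mu r =>
     inord (#|[set k | (wlen w k == x.1.+1) && (wtyp w k == x.2)]| %/ x.1.+1)].

Definition ch (C : numClosedFieldType) r (U : rmod C r) : series C r :=
  fun n a =>
    ((r ^ n * n`!)%N%:R)^-1 *
    \sum_(w in Wrn r n | wmono w == a)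
       \sum_(x : bas U (nobj r n)) mor U (I := nobj r n) (J := nobj r n) w x x.

Definition Zc (C : numClosedFieldType) r (A : rsp r) : series C r := ch (lin C A).

Definition expo r n (a : Mono r n) (j : nat) (z : mu r) : nat :=
  oapp (fun j' : 'I_n => nat_of_ord (a (j', z))) 0%N (insub j).

Definition resize r n m (a : Mono r n) : Mono r m :=
  [ffun x : 'I_m * mu r => inord (expo a x.1 x.2)].

Definition scoef (C : Type) r (g : series C r) n (a : Mono r n) : C :=
  g (mweight a) (resize _ a).

(* exponent of p_(j+1)(zeta) in the monomial obtained from b by p_l(zeta) |-> p_(il)(zeta) *)
Definition sexpo r n (i : nat) (b : Mono r n) (j : nat) (z : mu r) : nat :=
  if (i %| j.+1)%N then expo b (j.+1 %/ i).-1 z else 0%N.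

(* the parts of the partition lambda encoded by a monomial of A(1) *)
Definition mparts m (lam : Mono 1 m) : seq nat :=
  flatten [seq nseq (lam x) x.1.+1 | x <- enum [set: 'I_m * mu 1]].

(* f o g = sum_lambda f_lambda prod_(i in lambda) (p_i o g), where
   p_i o (sum_b g_b p_b) = sum_b g_b p_(i.b); only the positive-degree part of g
   is used (g is in A(r)_+). The coefficient of a (weight n) is computed as a
   finite sum over ordered tuples of monomials of g. *)
Definition pleth (C : numClosedFieldType) r (f : series C 1) (g : series C r) : series C r :=
  fun n a =>
  \sum_(m < n.+1) \sum_(lam : Mono 1 m | mweight lam == m)
     f m lam *
     \sum_(b : {ffun 'I_(size (mparts lam)) -> Mono r n} |
            [&& [forall k, (0 < mweight (b k))%N],
                (\sum_(k < size (mparts lam)) nth 0%N (mparts lam) k * mweight (b k))%N == n &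
                [forall x : 'I_n * mu r,
                   (\sum_(k < size (mparts lam)) sexpo (nth 0%N (mparts lam) k) (b k) x.1 x.2)%N == a x]])
        \prod_k scoef g (b k).

(* Main.v *)
Require Import Defs.
From HB Require Import structures.
From mathcomp Require Import all_boot all_order all_algebra all_fingroup.
From Stdlib Require Import FunctionalExtensionality.
Import GRing.Theory Num.Theory.
Local Open Scope ring_scope.
Set Implicit Arguments. Unset Strict Implicit. Unset Printing Implicit Defensive.

(** The trace of [w] on [(U o V)([n]_r)] is a sum over the [w]-invariant stable
    partitions [P]; its term at [P] is the trace of [U] at the permutation of the
    blocks, times one factor per cycle of blocks, namely the trace of [V] at the return
    map of [w] to one block of that cycle. Labelling the [m] blocks in all [m!] ways
    replaces [P] by a surjection [q : 'I_n -> K], [#|K| = m], together with a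
    permutation [s] of [K] such that [q w = s q].

    For fixed [s], with representatives [t j] of its cycles, summing over all pairs
    [(q, w)] a product over [j] of class functions of the return maps to the fibres
    over [t j] gives [#|W(r,n)|] times the product of the averages of these class
    functions. Indeed the permutations supported on the fibres over the [t j] act by
    left multiplication on the [w] over [s], and the return map is equivariant, so its
    fibres are equinumerous; the orders that remain to be computed come from the
    transitive action of [W(r,n)] on labellings with prescribed fibre sizes. Finally a
    cycle of length [m] and type [z] of the return map to a fibre over a [d]-cycle of
    [s] comes from a cycle of [w] of length [d m] and type [z], which is the rule
    [p_d o p_m(z) = p_(dm)(z)]. *)

(** * Sums over cycles of a permutation *)

Lemma big_dffun_distr (C : comPzSemiRingType) (I : finType) (T : I -> finType)
    (F : forall i, T i -> C) :
  \sum_(v : {dffun forall i, T i}) \prod_i F i (v i) = \prod_i \sum_(x : T i) F i x.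
Proof.
rewrite (reindex (@dffun_of_fprod I T)); last first.
  exact/onW_bij/dffun_of_fprod_bij.
pose P i := [ffun x => F i x].
transitivity (\sum_(t : fprod T) \prod_(i in I) P i (t i)).
  by apply: eq_bigr => t _; apply: eq_bigr => i _; rewrite !ffunE.
rewrite big_fprod; transitivity (\prod_(i : I) \sum_(j in tagged_with T i) untag 0 (P i) j).
  by rewrite bigA_distr_big_dep.
apply: eq_bigr => i _; rewrite -(big_tag (fun i x => P i x)).
by apply: eq_bigr => x _; rewrite ffunE.
Qed.

Section Transversal.
Variables (K J : finType) (s : K -> K) (t : J -> K).

(** The index type [J] is arbitrary, not the set of roots of [s], because the plethysm indexes
    cycles by positions in a list of parts. *)
Definition cycle_transversal :=
  [/\ injective s, forall k, exists j, fconnect s (t j) k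
    & forall i j, fconnect s (t i) (t j) -> i = j].

Hypothesis trst : cycle_transversal.

Lemma transversal_inj : injective t.
Proof. by case: trst => _ _ H i j e; apply: H; rewrite e connect0. Qed.

Lemma big_orbit (R : Type) (idx : R) (op : Monoid.com_law idx) (F : K -> R) k :
  \big[op/idx]_(i < fingraph.order s k) F (iter i s k) =
  \big[op/idx]_(l | fconnect s k l) F l.
Proof.
transitivity (\big[op/idx]_(l <- fingraph.orbit s k) F l).
  rewrite (big_nth k) big_mkord size_orbit; apply: eq_bigr => i _.
  by rewrite /fingraph.orbit nth_traject.
rewrite big_uniq ?orbit_uniq //.
by apply: eq_bigl => l; rewrite fconnect_orbit.
Qed.

Lemma big_orbits (R : Type) (idx : R) (op : Monoid.com_law idx) (F : K -> R) :
  \big[op/idx]_k F k =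
  \big[op/idx]_j \big[op/idx]_(i < fingraph.order s (t j)) F (iter i s (t j)).
Proof.
case: trst => injs tvc tvu.
transitivity (\big[op/idx]_j \big[op/idx]_(l | fconnect s (t j) l) F l); last first.
  by apply: eq_bigr => j _; rewrite big_orbit.
rewrite (exchange_big_dep predT) //=; apply: eq_bigr => k _.
have [j cj] := tvc k.
rewrite (big_pred1 j) // => i /=; apply/idP/eqP => [ci | -> //].
apply: tvu; apply: connect_trans ci _.
by rewrite fconnect_sym.
Qed.

Lemma iter_transversal_inj i j a b :
  (a < fingraph.order s (t i))%N -> (b < fingraph.order s (t j))%N ->
  iter a s (t i) = iter b s (t j) -> i = j /\ a = b.
Proof.
case: trst => injs tvc tvu ha hb e.
have eij : i = j.
  apply: tvu; apply: connect_trans (fconnect_iter s a _) _.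
  by rewrite e fconnect_sym // fconnect_iter.
subst j; split=> //.
by rewrite -(findex_iter ha) -(findex_iter hb) e.
Qed.

(** The points [iter i s (t j)], with [i] below the cycle length, enumerate [K] without repetition.
    A function on [K] is thus an independent choice of one function per cycle, and the sum
    factors. *)
Lemma sum_ffun_orbits (C : comPzSemiRingType) (W : finType)
    (G : forall j, {ffun 'I_(fingraph.order s (t j)) -> W} -> C) :
  \sum_(f : {ffun K -> W}) \prod_j G j [ffun i : 'I_(fingraph.order s (t j)) => f (iter i s (t j))]
  = \prod_j \sum_(p : {ffun 'I_(fingraph.order s (t j)) -> W}) G j p.
Proof.
case: trst => injs tvc tvu.
rewrite -big_dffun_distr.
pose T j : finType := {ffun 'I_(fingraph.order s (t j)) -> W}.
pose phi (p : {j & 'I_(fingraph.order s (t j))}) := iter (tagged p) s (t (tag p)).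
have phi_inj : injective phi.
  move=> [i a] [j b] /(iter_transversal_inj (ltn_ord a) (ltn_ord b))[] eij /= eab.
  by subst j; rewrite (val_inj eab).
have phi_surj k : exists p, phi p == k.
  have [j cj] := tvc k; exists (Tagged (fun j => 'I_(fingraph.order s (t j))) (Ordinal (findex_max cj))).
  by apply/eqP; rewrite /phi /= iter_findex.
pose phi' k := xchoose (phi_surj k).
have phiK k : phi (phi' k) = k by apply/eqP/(xchooseP (phi_surj k)).
have phi'K p : phi' (phi p) = p by apply: phi_inj; rewrite phiK.
rewrite [RHS](reindex (fun f : {ffun K -> W} =>
   [ffun j => [ffun i : 'I_(fingraph.order s (t j)) => f (iter i s (t j))]]
   : {dffun forall j, T j})) /=.
  by apply: eq_bigr => f _; apply: eq_bigr => j _; rewrite ffunE.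
apply: onW_bij.
exists (fun v : {dffun forall j, T j} => [ffun k => v (tag (phi' k)) (tagged (phi' k))]).
  move=> f; apply/ffunP => k; rewrite ffunE ffunE ffunE.
  by rewrite -/(phi (phi' k)) phiK.
move=> v; apply/ffunP => j; rewrite ffunE; apply/ffunP => i; rewrite !ffunE.
by rewrite -[iter i s (t j)]/(phi (Tagged (fun j => 'I_(fingraph.order s (t j))) i)) phi'K.
Qed.

End Transversal.

Section CycleTrace.
Variables (C : comPzSemiRingType) (W : finType).
Implicit Types N : nat -> W -> W -> C.

(** The product of the square matrices [N 0], ..., [N (d - 1)] over [W]. The factor depends on its
    position because successive steps along a cycle of blocks use different maps. *)
Fixpoint matprod N d (x y : W) : C :=
  if d is e.+1 then \sum_z matprod N e x z * N e z y else (x == y)%:R.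

Lemma sum_ffun_ord_recr d (F : {ffun 'I_d.+1 -> W} -> C) :
  \sum_p F p = \sum_(p : {ffun 'I_d -> W}) \sum_z
     F [ffun i => oapp p z (unlift ord_max i)].
Proof.
rewrite pair_big /=.
rewrite (reindex (fun q : {ffun 'I_d -> W} * W =>
   [ffun i => oapp q.1 q.2 (unlift ord_max i)])) //.
apply: onW_bij; exists (fun p : {ffun 'I_d.+1 -> W} => ([ffun i : 'I_d => p (lift ord_max i)], p ord_max)).
  move=> [p z]; congr pair; last by rewrite ffunE unlift_none.
  by apply/ffunP => i; rewrite !ffunE liftK.
move=> p; apply/ffunP => i; rewrite ffunE.
by case: unliftP => [j ->|->] /=; rewrite ?ffunE.
Qed.

(** The arbitrary weight [G] on the two endpoints makes the induction work: it absorbs the last step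
    of the path. *)
Lemma sum_path N d (G : W -> W -> C) :
  \sum_(p : {ffun 'I_d.+1 -> W})
     (\prod_(i < d) N i (p (inord i)) (p (inord i.+1))) * G (p ord0) (p ord_max)
  = \sum_x \sum_y matprod N d x y * G x y.
Proof.
elim: d G => [|d IH] G.
  transitivity (\sum_x G x x).
    rewrite (reindex (fun x : W => [ffun _ : 'I_1 => x])) /=.
      by apply: eq_bigr => x _; rewrite big_ord0 mul1r !ffunE.
    apply: onW_bij; exists (fun p : {ffun 'I_1 -> W} => p ord0).
      by move=> x; rewrite ffunE.
    by move=> p; apply/ffunP => i; rewrite ffunE (ord1 i).
  apply: eq_bigr => x _; rewrite (bigD1 x) //= eqxx mul1r big1 ?addr0 // => y.
  by rewrite eq_sym => /negPf->; rewrite mul0r.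
rewrite sum_ffun_ord_recr.
transitivity (\sum_(p : {ffun 'I_d.+1 -> W})
     (\prod_(i < d) N i (p (inord i)) (p (inord i.+1))) *
      \sum_z (N d (p ord_max) z * G (p ord0) z)).
  apply: eq_bigr => p _; rewrite big_distrr; apply: eq_bigr => z _ /=.
  rewrite !ffunE unlift_none /=.
  have Ep k : (k < d.+1)%N -> [ffun i => oapp p z (unlift ord_max i)] (inord k) = p (inord k).
    move=> hk; rewrite ffunE.
    have -> : inord k = lift ord_max (inord k : 'I_d.+1) :> 'I_d.+2.
      by apply: val_inj; rewrite /= (inordK hk) (inordK (ltnW hk)) /bump leqNgt hk.
    by rewrite liftK.
  have -> : unlift ord_max (ord0 : 'I_d.+2) = Some ord0.
    have -> : (ord0 : 'I_d.+2) = lift ord_max (ord0 : 'I_d.+1).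
      by apply: val_inj; rewrite /= /bump.
    by rewrite liftK.
  rewrite big_ord_recr /= Ep //.
  rewrite -!mulrA; congr (_ * _).
    by apply: eq_bigr => i _; rewrite (Ep i (ltnW (ltn_ord i))) (Ep i.+1 (ltn_ord i)).
  congr (_ * _); rewrite ffunE.
  have -> : inord d.+1 = ord_max :> 'I_d.+2 by apply: val_inj; rewrite /= inordK.
  rewrite unlift_none /=; congr (N _ (p _) _).
  by apply: val_inj; rewrite /= inordK.
rewrite (IH (fun x y => \sum_z (N d y z * G x z))); apply: eq_bigr => x _ /=.
under eq_bigr do rewrite big_distrr /=.
rewrite exchange_big /=; apply: eq_bigr => z _; rewrite big_distrl /=.
by apply: eq_bigr => y _; rewrite mulrA.
Qed.

(** Cut at [ord0], a closed path becomes an open one, and its closing step is the endpoint weight of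
    [sum_path]. *)
Lemma sum_closed_path N d : (0 < d)%N ->
  \sum_(p : {ffun 'I_d -> W}) \prod_(i < d) N i (p i) (p (ordS i))
  = \sum_x matprod N d x x.
Proof.
case: d => // d _; transitivity (\sum_x \sum_y matprod N d x y * N d y x).
  rewrite -(sum_path N d (fun x y => N d y x)); apply: eq_bigr => p _.
  rewrite big_ord_recr /=; congr (_ * _).
    apply: eq_bigr => i _; congr (N _ (p _) (p _)); apply: val_inj => /=.
      by rewrite inordK // ltnS ltnW.
    by rewrite modn_small ?inordK // ltnS.
  by congr (N _ (p _) (p _)); apply: val_inj; rewrite //= modnn.
by [].
Qed.

(* Expanding each trace as a sum over closed paths, a choice of one closed path
   per cycle of [s] is the same thing as a function on [K]. *)
Lemma sum_ffun_cycles (K J : finType) (s : K -> K) (t : J -> K)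
    (N : K -> W -> W -> C) : cycle_transversal s t ->
  \sum_(f : {ffun K -> W}) \prod_k N k (f k) (f (s k))
  = \prod_j \sum_x matprod (fun i => N (iter i s (t j))) (fingraph.order s (t j)) x x.
Proof.
move=> trst; case: (trst) => injs _ _.
under [RHS]eq_bigr do rewrite -sum_closed_path ?fingraph.order_gt0 //.
rewrite -(sum_ffun_orbits trst (fun j (p : {ffun _ -> W}) =>
  \prod_(i < fingraph.order s (t j)) N (iter i s (t j)) (p i) (p (ordS i)))).
apply: eq_bigr => f _; rewrite (big_orbits trst); apply: eq_bigr => j _.
apply: eq_bigr => i _; rewrite !ffunE -iterS; congr (N _ _ (f _)).
(* [ordS] wraps around only at the last position, where [iter_order] also brings the orbit back to
   [t j]. *)
have [lti|] := ltnP i.+1 (fingraph.order s (t j)); first by rewrite /= modn_small.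
move=> gei; have -> : i.+1 = fingraph.order s (t j).
  by apply/eqP; rewrite eqn_leq gei andbT.
have -> : ordS i = Ordinal (fingraph.order_gt0 s (t j)) :> 'I__.
  apply: val_inj => /=; have -> : i.+1 = fingraph.order s (t j).
    by apply/eqP; rewrite eqn_leq gei andbT.
  by rewrite modnn.
by rewrite iter_order.
Qed.

End CycleTrace.

(** * Objects and functoriality *)

Section Objects.
Variable r : nat.
Implicit Types I J K : obj r.

Lemma hom_inv I J (f : I -> J) : is_hom f ->
  exists g : J -> I, [/\ is_hom g, cancel f g & cancel g f].
Proof.
case=> -[g fK gK] fact; exists g; split=> //; split; first by exists f.
by move=> x z; rewrite -{1}[x]gK -fact fK.
Qed.

Lemma hom_comp I J K (f : I -> J) (g : J -> K) : is_hom f -> is_hom g -> is_hom (g \o f).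
Proof.
by case=> bf af [bg ag]; split=> [|x z]; [apply: bij_comp | rewrite /= af ag].
Qed.

Lemma hom_inj I J (f : I -> J) : is_hom f -> injective f.
Proof. by case=> /bij_inj. Qed.

Lemma hom_iter I (f : I -> I) d : is_hom f -> is_hom (iter d f).
Proof.
move=> hf; elim: d => [|d IH]; last by apply: (hom_comp IH hf).
by split=> //; exists id.
Qed.

Lemma val_act_sobj I (B : {set I}) (p : sobj B) z :
  stable B -> val (Defs.act (sobj B) p z) = Defs.act I (val p) z.
Proof.
by move/forall_inP/(_ _ (valP p))/forallP/(_ z) => h; rewrite val_insubd h.
Qed.

Lemma is_obj_sobj I (B : {set I}) : is_obj I -> stable B -> is_obj (sobj B).
Proof.
case=> a0 aD aF sB; split=> [x|x z1 z2|x z e].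
- by apply: val_inj; rewrite val_act_sobj // a0.
- by apply: val_inj; rewrite !val_act_sobj // aD.
- by apply: (aF (val x)); rewrite -val_act_sobj // e.
Qed.

Lemma hom_sobj I J (f : I -> J) (B : {set I}) (D : {set J}) (h : sobj B -> sobj D) :
  is_hom f -> stable B -> stable D -> f @: B = D ->
  (forall p, val (h p) = f (val p)) -> is_hom h.
Proof.
move=> hf sB sD E hE; have injf := hom_inj hf; split.
  apply: inj_card_bij => [p q e|]; first by apply/val_inj/injf; rewrite -!hE e.
  rewrite !card_sig.
  have -> : #|[pred x | x \in B]| = #|B| by apply: eq_card.
  have -> : #|[pred x | x \in D]| = #|D| by apply: eq_card.
  by rewrite -E leq_imset_card.
by move=> p z; apply: val_inj; rewrite hE !val_act_sobj // hE; case: hf.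
Qed.

Lemma stable_imset I J (f : I -> J) (B : {set I}) : is_hom f -> stable B -> stable (f @: B).
Proof.
case=> _ af /forall_inP sB; apply/forall_inP => y /imsetP[x xB ->].
by apply/forallP => z; rewrite -af imset_f //; have /forallP := sB x xB.
Qed.

(** The default [p] is reached only where [f] leaves [B]. Totality lets this restriction be written
    under sums without a proof of [f @: B = B]. *)
Definition rs I (f : I -> I) (B : {set I}) : sobj B -> sobj B :=
  fun p => insubd p (f (val p)).

Lemma val_rs I (f : I -> I) (B : {set I}) p : f @: B = B -> val (rs f p : sobj B) = f (val p).
Proof.
move=> E; have h : f (val p) \in B by have := imset_f f (valP p); rewrite E.
by rewrite val_insubd h.
Qed.

Lemma hom_rs I (f : I -> I) (B : {set I}) : is_hom f -> stable B -> f @: B = B ->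
  is_hom (@rs I f B).
Proof. by move=> hf sB E; apply: (hom_sobj hf) => // p; apply: val_rs. Qed.

End Objects.

(** * Traces and block matrices of a module *)

Section Modules.
Variables (C : numClosedFieldType) (r : nat) (V : rmod C r).

Definition trm (I : obj r) (f : I -> I) : C := \sum_x mor V f x x.

Hypothesis modV : is_mod V.

(** Write [f] as [psi \o (g \o phi)] with [psi] inverse to [phi]; by cyclicity of the trace [psi]
    meets [phi], and their composite gives the identity matrix. *)
Lemma trm_conj (I J : obj r) (phi : I -> J) (f : I -> I) (g : J -> J) :
  is_obj I -> is_obj J -> is_hom phi -> is_hom f -> is_hom g ->
  (forall x, phi (f x) = g (phi x)) -> trm f = trm g.
Proof.
case: modV => mor1 morM oI oJ hphi hf hg e.
have [psi [hpsi phiK psiK]] := hom_inv hphi.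
have -> : f = psi \o (g \o phi).
  by apply: functional_extensionality => x /=; rewrite -e phiK.
have hgp : is_hom (g \o phi) by apply: hom_comp.
transitivity (\sum_x \sum_z \sum_y mor V g y z * (mor V psi z x * mor V phi x y)).
  apply: eq_bigr => x _; rewrite morM //; apply: eq_bigr => z _.
  rewrite morM // big_distrl /=; apply: eq_bigr => y _.
  by rewrite mulrAC mulrC [mor V phi x y * _]mulrC.
rewrite exchange_big /=.
transitivity (\sum_z \sum_y mor V g y z * (z == y)%:R).
  apply: eq_bigr => z _; rewrite exchange_big /=; apply: eq_bigr => y _.
  rewrite -big_distrr /= -morM //; congr (_ * _).
  rewrite -(mor1 J oJ); congr (mor V _ z y).
  by apply: functional_extensionality => x /=.
apply: eq_bigr => z _; rewrite (bigD1 z) //= eqxx mulr1 big1 ?addr0 // => y.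
by rewrite eq_sym => /negPf->; rewrite mulr0.
Qed.

(* Extending by 0 when [f] does not map [B] onto [D] makes functoriality a sum over
   all blocks, so that no casts occur in matrix products. *)
Definition blockmor (I : obj r) (f : I -> I) (B D : {set I})
    (x : bas V (sobj B)) (y : bas V (sobj D)) : C :=
  match f @: B =P D with
  | ReflectT E => mor V (I := sobj B) (J := sobj (f @: B)) (@restr I I f B)
                    x (ecast A (bas V (sobj A)) (esym E) y)
  | ReflectF _ => 0
  end.

(** Any [h] with underlying map [f] is allowed, so that [restr], [rs] and the identity are treated
    alike. *)
Lemma blockmorE (I : obj r) (f : I -> I) (B D : {set I}) (h : sobj B -> sobj D) x y :
  f @: B = D -> (forall p, val (h p) = f (val p)) ->
  blockmor f x y = mor V h x y.
Proof.
move=> E; rewrite /blockmor; case: eqP => // E'; move: h y; clear E; case: _ / E' => h y hE.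
congr (mor V _ x y); apply: functional_extensionality => p.
by apply: val_inj; rewrite hE.
Qed.

Lemma blockmor0 (I : obj r) (f : I -> I) (B D : {set I}) (x : bas V (sobj B))
  (y : bas V (sobj D)) : f @: B != D -> blockmor f x y = 0.
Proof. by rewrite /blockmor; case: eqP. Qed.

Section Blocks.
Variables (I : obj r) (P : {set {set I}}).
Hypothesis oI : is_obj I.

Let W : finType := {B : blk P & bas V (sobj (val B))}.

(** Only basis vectors over the block [f @: B] contribute to the sum over [W], and on them the claim
    is functoriality of [V]. *)
Lemma blockmor_comp (f w : I -> I) (B D : {set I}) (x : bas V (sobj B))
    (y : bas V (sobj D)) :
  is_hom f -> is_hom w -> stable B -> f @: B \in P ->
  \sum_(u : W) blockmor f x (tagged u) * blockmor w (tagged u) y =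
  blockmor (w \o f) x y.
Proof.
move=> hf hw sB fBP.
rewrite -(@sig_big_dep _ _ _ (blk P) (fun A => bas V (sobj (val A))) predT (fun _ => predT)
  (fun A u => blockmor f x u * blockmor w u y)) /=.
rewrite (bigD1 (exist _ (f @: B) fBP : blk P)) //= [X in _ + X]big1 ?addr0; last first.
  move=> A nA; apply: big1 => u _; rewrite (blockmor0 (f := f)) ?mul0r //.
  by move: nA; rewrite eq_sym -val_eqE.
have sfB := stable_imset hf sB.
have [E|nE] := eqVneq (w @: (f @: B)) D; last first.
  rewrite (blockmor0 (f := w \o f)); last by rewrite imset_comp.
  by apply: big1 => u _; rewrite (blockmor0 (f := w)) // mulr0.
move: y; case: _ / E => y.
have swfB := stable_imset hw sfB.
transitivity (mor V (I := sobj B) (J := sobj (w @: (f @: B)))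
   (@restr I I w (f @: B) \o @restr I I f B) x y); last first.
  by symmetry; apply: blockmorE => //; rewrite imset_comp.
case: modV => _ morM; rewrite (morM (sobj B) (sobj (f @: B))); try exact: is_obj_sobj.
- apply: eq_bigr => u _; congr (_ * _); exact: blockmorE.
- by apply: (hom_sobj hf).
- by apply: (hom_sobj hw).
Qed.

End Blocks.
End Modules.

(** A dependent function is a section of the tagged sum. Passing to ordinary functions puts all the
    spaces over one index type, as the expansion into closed paths requires. *)
Lemma sum_dffun_sections (C : comPzSemiRingType) (I : finType) (T : I -> finType)
    (G : {ffun I -> {i : I & T i}} -> C) :
  \sum_(v : {dffun forall i, T i}) G [ffun i => Tagged T (v i)] =
  \sum_(f in family (tagged_with T)) G f.
Proof.
rewrite (reindex (@dffun_of_fprod I T)); last exact/onW_bij/dffun_of_fprod_bij.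
rewrite (big_sub (family (tagged_with T))).
rewrite (reindex (@to_family_tagged_with I T)) /=; last first.
  exact/onW_bij/to_family_tagged_with_bij.
apply: eq_bigr => v _; congr G; apply/ffunP => i; rewrite !ffunE.
exact: etaggedK.
Qed.

(** * Trace of a map that permutes tensor factors *)

Section TensorTrace.
Variables (C : numClosedFieldType) (r : nat) (V : rmod C r).
Hypothesis modV : is_mod V.
Variables (I : obj r) (P : {set {set I}}) (w : I -> I).
Hypotheses (oI : is_obj I) (sP : forall B, B \in P -> stable B) (hw : is_hom w).
Variable h : [forall B : blk P, w @: val B \in P].

(** [W] is a basis of the direct sum of the spaces V(B). In [N B] only the rows over [B] survive,
    which confines a sum over all functions to sections. *)
Let W : finType := {B : blk P & bas V (sobj (val B))}.
Let N (B : blk P) (x y : W) : C := (tag x == B)%:R * blockmor w (tagged x) (tagged y).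

Lemma val_iter_bmap d B : val (iter d (bmap h) B) = iter d w @: val B.
Proof.
elim: d => [|d IH] /=; first by rewrite imset_id.
by rewrite IH -imset_comp.
Qed.

Lemma matprod_blockmor d c (x y : W) : tag x = c ->
  matprod (fun i => N (iter i (bmap h) c)) d x y =
  blockmor (iter d w) (tagged x) (tagged y).
Proof.
move=> <- {c}; elim: d y => [|d IH] y /=.
  case: x y => B x [D y] /=; have [E|nE] := eqVneq B D.
    subst D; rewrite eq_Tagged /= (@blockmorE _ _ V I _ _ _ id) ?imset_id //.
    by case: modV => m1 _; rewrite m1 //; apply/is_obj_sobj/sP/(valP B).
  rewrite -tag_eqE /tag_eq /= (negPf nE) blockmor0 // imset_id.
  by rewrite val_eqE.
transitivity (\sum_(z : W) blockmor (iter d w) (tagged x) (tagged z) *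
    blockmor w (tagged z) (tagged y)).
  apply: eq_bigr => z _; rewrite IH /N.
  case: eqP => [_|/eqP nz]; rewrite ?mul1r // mul0r mulr0.
  rewrite (blockmor0 (f := iter d w)) ?mul0r // -val_iter_bmap.
  by rewrite val_eqE eq_sym.
rewrite (blockmor_comp modV oI) //; first exact: hom_iter.
  exact/sP/valP.
by rewrite -val_iter_bmap; apply: valP.
Qed.

(** The length is [d.+1] because the empty product is the identity, whose diagonal entries over the
    other blocks do not vanish. *)
Lemma matprod_blockmor0 d c (x y : W) : tag x != c ->
  matprod (fun i => N (iter i (bmap h) c)) d.+1 x y = 0.
Proof.
move=> nx; elim: d y => [|d IH] y.
  rewrite /= big1 // => z _; case: eqP => [<-|]; last by rewrite mul0r.
  by rewrite /N (negPf nx) mul0r mulr0.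
by rewrite [LHS]/= big1 // => z _; rewrite -/(matprod _ d.+1 x z) IH mul0r.
Qed.

(** The trace of a map that permutes tensor factors cyclically is the trace of its composite around
    the cycle. The expansion into closed paths yields matrix products, which functoriality
    identifies with an iterate of [w] on one block. *)
Lemma trace_tensor (J : finType) (t : J -> blk P) : cycle_transversal (bmap h) t ->
  \sum_(v : {dffun forall B : blk P, bas V (sobj (val B))})
     \prod_(B : blk P) mor V (I := sobj (val B)) (J := sobj (w @: val B))
        (@restr I I w (val B)) (v B) (v (bmap h B))
  = \prod_j trm V (@rs r I (iter (fingraph.order (bmap h) (t j)) w) (val (t j))).
Proof.
move=> trt.
transitivity (\sum_(f : {ffun blk P -> W}) \prod_B N B (f B) (f (bmap h B))).
  rewrite [RHS](bigID (mem (family (tagged_with (fun B : blk P => bas V (sobj (val B))))))) /=.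
  rewrite [X in _ + X]big1 ?addr0 => [|f].
    rewrite -sum_dffun_sections; apply: eq_bigr => v _; apply: eq_bigr => B _.
    rewrite !ffunE /N /= eqxx mul1r; symmetry; exact: blockmorE.
  move=> /familyP nf.
  have [B nB] : exists B, f B \notin tagged_with (fun B : blk P => bas V (sobj (val B))) B.
    by apply/existsP; rewrite -negb_forall; apply/negP => /forallP.
  rewrite (bigD1 B) //= /N; rewrite !inE in nB.
  by rewrite (negPf nB) !mul0r.
rewrite (sum_ffun_cycles _ trt); apply: eq_bigr => j _.
have ordE : iter (fingraph.order (bmap h) (t j)) w @: val (t j) = val (t j).
  by rewrite -val_iter_bmap iter_order //; case: trt.
have := fingraph.order_gt0 (bmap h) (t j).
case: (fingraph.order _ _) ordE => // d ordE _.
transitivity (\sum_(x : W | tag x == t j) blockmor (iter d.+1 w) (tagged x) (tagged x)).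
  rewrite [RHS]big_mkcond; apply: eq_bigr => x _; case: eqP => [|/eqP].
    exact: matprod_blockmor.
  exact: matprod_blockmor0.
transitivity (\sum_(x : W | (tag x == t j) && true)
    blockmor (iter d.+1 w) (tagged x) (tagged x)).
  by apply: eq_bigl => x; rewrite andbT.
rewrite -(@sig_big_dep _ _ _ (blk P) (fun A => bas V (sobj (val A))) (pred1 (t j))
  (fun _ => predT) (fun A u => blockmor (iter d.+1 w) u u)) /= big_pred1_eq.
apply: eq_bigr => x _; apply: blockmorE => // p; exact: val_rs.
Qed.

End TensorTrace.

(** * Permutations preserving a labelling *)

Section PermOfFun.
Variable T : finType.

(* Junk value: the identity when [g] is not injective. *)
Definition perm_of_fun (g : T -> T) : {perm T} :=
  odflt 1%g [pick u : {perm T} | [forall x, u x == g x]].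

Lemma perm_of_funE g : injective g -> perm_of_fun g =1 g.
Proof.
move=> injg x; rewrite /perm_of_fun; case: pickP => [u /forallP/(_ x)/eqP //|].
by move/(_ (perm injg))/negbT/negP; case; apply/forallP => y; rewrite permE.
Qed.

End PermOfFun.

Section FreeObjects.
Variables (r n : nat).
Local Notation X := (mu r * 'I_n)%type.
Implicit Types (w : {perm X}).

Lemma is_obj_nobj : is_obj (nobj r n).
Proof.
split=> [[z i]|[z i] z1 z2|[z i] z1] /=; rewrite ?addr0 ?addrA //.
by case=> /(canRL (addKr _)); rewrite addNr.
Qed.

Lemma Wrn_hom w : (w \in Wrn r n) <-> is_hom (I := nobj r n) (J := nobj r n) w.
Proof.
rewrite inE; split.
  move/forallP=> H; split; first exact: (Bijective (permK w) (permKV w)).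
  by move=> x z /=; have /forallP/(_ z)/eqP := H x.
by case=> _ H; apply/forallP => x; apply/forallP => z; apply/eqP/H.
Qed.

Lemma WrnE w z i : w \in Wrn r n -> w (z, i) = ((w (0, i)).1 + z, wsig w i).
Proof. by move/Wrn_hom => [_ /(_ (0, i) z)] /=; rewrite add0r. Qed.

Lemma Wrn_snd w x : w \in Wrn r n -> (w x).2 = wsig w x.2.
Proof. by case: x => z i wW; rewrite (WrnE _ _ wW). Qed.

Lemma wsig_inj w : w \in Wrn r n -> injective (wsig w).
Proof.
move=> wW i j e.
have : w (0, i) = w ((w (0, i)).1 - (w (0, j)).1, j).
  by rewrite [RHS]WrnE // [_ + (_ - _)]addrC subrK -e /wsig; case: (w (0, i)).
by move/perm_inj => -[].
Qed.

Lemma WrnM w1 w2 : w1 \in Wrn r n -> w2 \in Wrn r n -> (w1 * w2)%g \in Wrn r n.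
Proof.
move=> /Wrn_hom h1 /Wrn_hom h2; apply/Wrn_hom; have [_ H] := hom_comp h1 h2.
split; first exact: (Bijective (permK _) (permKV _)).
by move=> x z; rewrite !permM; apply: H.
Qed.

Lemma WrnV w : w \in Wrn r n -> (w^-1)%g \in Wrn r n.
Proof.
move=> /Wrn_hom [_ H]; apply/Wrn_hom; split.
  exact: (Bijective (permK _) (permKV _)).
by move=> x z; apply: (perm_inj (s := w)); rewrite permKV H permKV.
Qed.

End FreeObjects.

Section Labellings.
Variables (r n : nat) (K : finType).
Local Notation X := (mu r * 'I_n)%type.
Implicit Types (x : X) (w a : {perm X}) (q : {ffun 'I_n -> K}).

Definition fibre q (k : K) : {set nobj r n} := [set x | q x.2 == k].
Definition fibsize q (k : K) : nat := #|[set i | q i == k]|.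
Definition lifts q' q : {set {perm X}} :=
  [set w in Wrn r n | [forall x, q (w x).2 == q' x.2]].
(** This is the product, over [k] in [R], of the groups W(r, [fibsize q k]), each acting on the
    fibre over [k]. *)
Definition fibperms q (R : {set K}) : {set {perm X}} :=
  [set a in Wrn r n | [forall x, (q (a x).2 == q x.2) && ((q x.2 \notin R) ==> (a x == x))]].

Lemma stable_fibre q k : stable (fibre q k).
Proof. by apply/forall_inP => x; rewrite inE => qx; apply/forallP => z; rewrite inE. Qed.

Lemma liftsP q' q w :
  reflect (w \in Wrn r n /\ forall x, q (w x).2 = q' x.2) (w \in lifts q' q).
Proof.
rewrite [X in reflect _ X]in_set; apply: (iffP andP) => -[wW H]; split=> //.
  by move=> x; apply/eqP/(forallP H).
by apply/forallP => x; apply/eqP.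
Qed.

Lemma fibpermsP q (R : {set K}) a :
  reflect [/\ a \in Wrn r n, forall x, q (a x).2 = q x.2 &
              forall x, q x.2 \notin R -> a x = x] (a \in fibperms q R).
Proof.
rewrite [X in reflect _ X]in_set; apply: (iffP andP) => [[aW /forallP H]|[aW H1 H2]]; split=> //.
- by move=> x; case/andP: (H x) => /eqP.
- by move=> x xR; case/andP: (H x) => _ /implyP/(_ xR)/eqP.
- apply/forallP => x; rewrite H1 eqxx /=; apply/implyP => xR.
  by rewrite H2.
Qed.

Lemma fibperms_imset q R a k : a \in fibperms q R -> a @: fibre q k = fibre q k.
Proof.
case/fibpermsP=> _ aq _; apply/eqP; rewrite eqEcard card_imset ?leqnn ?andbT; last first.
  exact: perm_inj.
by apply/subsetP => y /imsetP[x]; rewrite !inE => /eqP <- ->; rewrite aq.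
Qed.

Lemma card_fibre q k : #|fibre q k| = (r.-1.+1 * fibsize q k)%N.
Proof.
have -> : fibre q k = setX [set: mu r] [set i | q i == k].
  by apply/setP => x; rewrite !inE.
by rewrite cardsX cardsT card_ord.
Qed.

Section Glue.
Variables (q : {ffun 'I_n -> K}) (J : finType) (t : J -> K).
Hypothesis injt : injective t.
Let R := [set t j | j in J].

Let glue_fun (p : {ffun J -> {perm X}}) (x : X) : X :=
  if [pick j | t j == q x.2] is Some j then p j x else x.
Let glue p := perm_of_fun (glue_fun p).
Let part_fun a j (x : X) : X := if q x.2 == t j then a x else x.
Let part a := [ffun j => perm_of_fun (part_fun a j)].

Let glue_funE p x j : q x.2 = t j -> glue_fun p x = p j x.
Proof.
move=> e; rewrite /glue_fun; case: pickP => [i /eqP|/(_ j)]; rewrite e ?eqxx //.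
by move/injt ->.
Qed.

Let glue_fun_out p x : q x.2 \notin R -> glue_fun p x = x.
Proof.
move=> nR; rewrite /glue_fun; case: pickP => // j /eqP e.
by case/negP: nR; rewrite -e imset_f.
Qed.

Let RP (x : X) : {j | q x.2 = t j} + {q x.2 \notin R}.
Proof.
case: (pickP [pred j | q x.2 == t j]) => [j /eqP|H]; first by left; exists j.
by right; apply/imsetP => -[j _ e]; have := H j; rewrite /= e eqxx.
Qed.

Let glue_fun_inj p : p \in family (fun j => mem (fibperms q [set t j])) ->
  injective (glue_fun p) /\ forall x, q (glue_fun p x).2 = q x.2.
Proof.
move=> /familyP pA.
have pq x : q (glue_fun p x).2 = q x.2.
  case: (RP x) => [[j e]|e]; last by rewrite glue_fun_out.
  by rewrite (glue_funE _ e); have /fibpermsP[_ -> _] := pA j.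
split=> // x y e; have eq : q x.2 = q y.2 by rewrite -pq e pq.
case: (RP x) => [[j ex]|ex].
  have ey : q y.2 = t j by rewrite -eq.
  by move: e; rewrite (glue_funE _ ex) (glue_funE _ ey); apply: perm_inj.
by move: e; rewrite !glue_fun_out // -eq.
Qed.

Let part_fun_inj a j : a \in fibperms q R -> injective (part_fun a j).
Proof.
case/fibpermsP=> _ aq _ x y; rewrite /part_fun.
case: eqP => ex; case: eqP => ey; [exact: perm_inj | | | by []].
  by move=> e; case: ey; rewrite -e aq.
by move=> e; case: ex; rewrite e aq.
Qed.

Let partE a j x : a \in fibperms q R ->
  part a j x = if q x.2 == t j then a x else x.
Proof. by move=> aA; rewrite ffunE perm_of_funE //; apply: part_fun_inj. Qed.

Let part_in a : a \in fibperms q R -> part a \in family (fun j => mem (fibperms q [set t j])).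
Proof.
move=> aA; apply/familyP => j; apply/fibpermsP; split=> [|x|x]; rewrite ?partE //.
- apply/Wrn_hom; split; first exact: (Bijective (permK _) (permKV _)).
  move=> x z; rewrite !partE //=; case: ifP => // _.
  by case/fibpermsP: aA => /Wrn_hom[_ H] _ _; apply: H.
- by case: ifP => // _; case/fibpermsP: aA.
- by rewrite inE => /negPf->.
Qed.

Let glue_in p : p \in family (fun j => mem (fibperms q [set t j])) -> glue p \in fibperms q R.
Proof.
move=> pA; have [gi gq] := glue_fun_inj pA; move/familyP: (pA) => pA'.
apply/fibpermsP; split=> [|x|x nR]; rewrite ?perm_of_funE //.
- apply/Wrn_hom; split; first exact: (Bijective (permK _) (permKV _)).
  move=> x z; rewrite !perm_of_funE //=.
  case: (RP x) => [[j e]|e]; last by rewrite !glue_fun_out.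
  rewrite !(@glue_funE p _ j) //.
  by have /fibpermsP[/Wrn_hom[_ H] _ _] := pA' j; apply: H.
- exact: glue_fun_out.
Qed.

Let glueK p : p \in family (fun j => mem (fibperms q [set t j])) -> part (glue p) = p.
Proof.
move=> pA; have [gi gq] := glue_fun_inj pA.
apply/ffunP => j; apply/permP => x; rewrite partE ?glue_in // perm_of_funE //.
case: eqP => [e|ne]; first exact: glue_funE.
move/familyP: pA => /(_ j)/fibpermsP[_ _ H]; rewrite H // inE; exact/eqP.
Qed.

Let partK a : a \in fibperms q R -> glue (part a) = a.
Proof.
move=> aA; have [gi gq] := glue_fun_inj (part_in aA).
apply/permP => x; rewrite perm_of_funE //.
case: (RP x) => [[j e]|e].
  by rewrite (glue_funE _ e) partE // e eqxx.
by rewrite glue_fun_out //; case/fibpermsP: aA => _ _ ->.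
Qed.

(** [glue] and [part] identify [fibperms q R] with the direct product of the groups attached to
    single labels. As [f j] sees only the fibre over [t j], the sum factors. *)
Lemma sum_fibperms (C : comPzSemiRingType) (f : J -> {perm X} -> C) :
  (forall j (a b : {perm X}), (forall x, q x.2 = t j -> a x = b x) -> f j a = f j b) ->
  \sum_(a in fibperms q R) \prod_j f j a = \prod_j \sum_(a in fibperms q [set t j]) f j a.
Proof.
move=> fext; rewrite bigA_distr_big_dep.
rewrite (reindex_onto glue part) => [|a]; last exact: partK.
apply: eq_big => [p|p /andP[gA /eqP gK]].
  apply/andP/idP => [[gA /eqP <-]|pA]; first exact: part_in.
  by rewrite glue_in ?glueK.
have pA : p \in family (fun j => mem (fibperms q [set t j])) by rewrite -gK part_in.
apply: eq_bigr => j _; apply: fext => x e.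
by rewrite -[in RHS]gK partE // e eqxx.
Qed.

Lemma card_fibperms : #|fibperms q R| = (\prod_j #|fibperms q [set t j]|)%N.
Proof.
apply/eqP; rewrite -(eqr_nat int) natr_prod -sumr_const.
transitivity (\sum_(a in fibperms q R) \prod_(j in J) (1 : int) == \prod_j #|fibperms q [set t j]|%:R).
  by congr (_ == _); apply: eq_bigr => a _; rewrite big1.
rewrite (@sum_fibperms _ (fun _ _ => 1)) //.
by apply/eqP/eq_bigr => j _; rewrite sumr_const.
Qed.

End Glue.
End Labellings.

(** A class function on all objects at once: comparing along isomorphisms of different objects
    carries its values from a fibre to a standard object. *)
Definition conj_invariant (C : Type) r (H : forall I : obj r, (I -> I) -> C) : Prop :=
  forall (I J : obj r) (f : I -> J) (g : I -> I) (h : J -> J), is_obj I -> is_obj J ->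
     is_hom f -> is_hom g -> is_hom h -> (forall x, f (g x) = h (f x)) -> H I g = H J h.

Section SingleFibre.
Variables (r n : nat) (K : finType) (q : {ffun 'I_n -> K}) (k : K).
Local Notation X := (mu r * 'I_n)%type.
Local Notation m := (fibsize q k).

(** An equivariant parametrization of the fibre over [k] by a standard object. Extension by the
    identity along it identifies [Wrn r m] with [fibperms r q [set k]]. *)
Let phi (y : nobj r m) : X := (y.1, enum_val y.2).

Let phi_inj : injective phi.
Proof. by move=> [z i] [z' j] [-> /enum_val_inj ->]. Qed.

Let phi_fibre y : q (phi y).2 = k.
Proof. by have := enum_valP y.2; rewrite inE => /eqP. Qed.

Let phi_surj x : q x.2 = k -> exists y, phi y = x.
Proof.
move=> e; have xA : x.2 \in [set i | q i == k] by rewrite inE e.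
by exists (x.1, enum_rank_in xA x.2); rewrite /phi /= enum_rankK_in //; case: x {e xA}.
Qed.

Let ext_fun (u : {perm (mu r * 'I_m)}) (x : X) : X :=
  if [pick y | phi y == x] is Some y then phi (u y) else x.
Let ext u := perm_of_fun (ext_fun u).

Let ext_fun_phi u y : ext_fun u (phi y) = phi (u y).
Proof.
rewrite /ext_fun; case: pickP => [y' /eqP/phi_inj -> //|/(_ y)]; by rewrite eqxx.
Qed.

Let ext_fun_out u x : q x.2 != k -> ext_fun u x = x.
Proof.
move=> nk; rewrite /ext_fun; case: pickP => // y /eqP e.
by case/eqP: nk; rewrite -e phi_fibre.
Qed.

Let ext_fun_q u x : q (ext_fun u x).2 = q x.2.
Proof.
have [/phi_surj[y <-]|nk] := eqVneq (q x.2) k; last by rewrite ext_fun_out.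
by rewrite ext_fun_phi !phi_fibre.
Qed.

Let ext_fun_inj u : injective (ext_fun u).
Proof.
move=> x y e; have eq : q x.2 = q y.2 by rewrite -(ext_fun_q u) e ext_fun_q.
have [ex|nx] := eqVneq (q x.2) k; last by move: e; rewrite !ext_fun_out // -eq.
have ey : q y.2 = k by rewrite -eq.
have [x' xE] := phi_surj ex; have [y' yE] := phi_surj ey.
by move: e; rewrite -xE -yE !ext_fun_phi => /phi_inj/perm_inj ->.
Qed.

Let extE u x : ext u x = ext_fun u x.
Proof. exact: perm_of_funE. Qed.

Let ext_in u : u \in Wrn r m -> ext u \in fibperms r q [set k].
Proof.
move/Wrn_hom => [_ H]; apply/fibpermsP; split=> [|x|x].
- apply/Wrn_hom; split; first exact: (Bijective (permK _) (permKV _)).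
  move=> x z; rewrite !extE /=.
  have [ex|nx] := eqVneq (q x.2) k; last by rewrite !ext_fun_out.
  have [y yE] := phi_surj ex; rewrite -yE ext_fun_phi.
  rewrite -[((phi y).1 + z, (phi y).2)]/(phi (y.1 + z, y.2)) ext_fun_phi.
  by have /= -> := H y z.
- by rewrite extE ext_fun_q.
- by rewrite inE extE; apply: ext_fun_out.
Qed.

Let ext_inj : injective ext.
Proof.
by move=> u v e; apply/permP => y; apply: phi_inj; rewrite -!ext_fun_phi -!extE e.
Qed.

Let ext_imset : ext @: Wrn r m = fibperms r q [set k].
Proof.
apply/setP => a; apply/imsetP/idP => [[u uW ->]|aA]; first exact: ext_in.
have [aW aq aout] := fibpermsP _ _ _ aA.
have ex y : exists y', phi y' == a (phi y).
  by have [|y' yE] := @phi_surj (a (phi y)); [rewrite aq phi_fibre | exists y'; rewrite yE].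
pose f y := xchoose (ex y).
have fE y : phi (f y) = a (phi y) by apply/eqP/(xchooseP (ex y)).
have injf : injective f by move=> y y' e; apply/phi_inj/(@perm_inj _ a); rewrite -!fE e.
exists (perm injf).
  apply/Wrn_hom; split; first exact: (Bijective (permK _) (permKV _)).
  move=> y z; rewrite !permE; apply: phi_inj; rewrite fE.
  transitivity ((phi (f y)).1 + z, (phi (f y)).2); last by [].
  by rewrite fE; have /Wrn_hom[_ /(_ (phi y) z)] := aW.
apply/permP => x; rewrite extE; have [ex'|nx] := eqVneq (q x.2) k.
  by have [y <-] := phi_surj ex'; rewrite ext_fun_phi permE fE.
by rewrite ext_fun_out // aout // inE.
Qed.

Lemma sum_fibperms1 (C : comPzSemiRingType) (H : forall I : obj r, (I -> I) -> C) :
  conj_invariant H ->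
  \sum_(a in fibperms r q [set k]) H _ (@rs r (nobj r n) a (fibre r q k)) =
  \sum_(u in Wrn r m) H (nobj r m) u.
Proof.
move=> Hconj; rewrite -ext_imset big_imset /=; last by move=> u v _ _; apply: ext_inj.
apply: eq_bigr => u uW.
have phiF y : phi y \in fibre r q k by rewrite inE phi_fibre.
have sF := @stable_fibre r n K q k; have oF := is_obj_sobj (is_obj_nobj r n) sF.
have extA := ext_in uW.
have extW : is_hom (I := nobj r n) (J := nobj r n) (ext u).
  by apply/Wrn_hom; case/fibpermsP: extA.
symmetry; apply: (Hconj _ _ (fun y => exist _ (phi y) (phiF y) : sobj (fibre r q k))) => //.
- exact: is_obj_nobj.
- split; last first.
    by move=> y z; apply: val_inj; rewrite val_act_sobj.
  apply: inj_card_bij => [y y' /(congr1 val) /phi_inj //|].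
  have -> : #|sobj (fibre r q k)| = #|fibre r q k| by rewrite card_sig; apply: eq_card.
  by rewrite card_fibre card_prod !card_ord.
- exact/Wrn_hom.
- apply: hom_rs => //; exact: fibperms_imset extA.
- move=> y; apply: val_inj; rewrite val_rs; last exact: fibperms_imset extA.
  by symmetry; rewrite [LHS]extE ext_fun_phi.
Qed.

Lemma card_fibperms1 : #|fibperms r q [set k]| = #|Wrn r m|.
Proof. by rewrite -ext_imset card_imset. Qed.

End SingleFibre.

Section CountLabellings.
Variables (r n : nat) (K : finType).
Local Notation X := (mu r * 'I_n)%type.
Implicit Types (q : {ffun 'I_n -> K}) (w : {perm X}).

Lemma count_labelling q k : count_mem k [tuple q i | i < n] = fibsize q k.
Proof.
rewrite /= count_map /fibsize cardE [in RHS]/enum_mem size_filter -[Finite.enum _]enumT.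
by apply: eq_count => i; rewrite /= inE.
Qed.

(** Labellings with equal fibre sizes differ by a permutation of the indices, which gives one lift
    [w0]. The lifts are then the products [w0 * a] with [a] preserving all labels of [q]. *)
Lemma card_lifts q q' : (forall k, fibsize q' k = fibsize q k) ->
  #|lifts r q' q| = (\prod_k #|Wrn r (fibsize q k)|)%N.
Proof.
move=> sz.
have /tuple_permP[s sE] : perm_eq [tuple q' i | i < n] [tuple q i | i < n].
  by apply/allP => k _ /=; rewrite -!/(tval (mktuple _)) !count_labelling sz.
have qs i : q' i = q (s i).
  have := congr1 (fun l => nth (q' i) l i) sE.
  by rewrite -!tnth_nth !tnth_mktuple.
have w0_inj : injective (fun x : X => (x.1, s x.2)) by move=> [z i] [z' j] [-> /perm_inj ->].
pose w0 := perm w0_inj.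
have w0W : w0 \in Wrn r n.
  apply/Wrn_hom; split; first exact: (Bijective (permK _) (permKV _)).
  by move=> x z; rewrite !permE.
have qw0 x : q (w0 x).2 = q' x.2 by rewrite permE /= qs.
have -> : lifts r q' q = [set (w0 * a)%g | a in fibperms r q [set: K]].
  apply/setP => w; apply/liftsP/imsetP => [[wW qw]|[a /fibpermsP[aW aq _] ->]].
    exists (w0^-1 * w)%g; last by rewrite mulKVg.
    apply/fibpermsP; split=> [|x|x]; last by rewrite inE.
      by apply: WrnM => //; apply: WrnV.
    by rewrite permM qw -qw0 permKV.
  by split=> [|x]; [apply: WrnM | rewrite permM aq qw0].
rewrite card_imset; last exact: mulgI.
have -> : [set: K] = [set (id : K -> K) j | j in K].
  by apply/setP => k; rewrite inE; symmetry; apply/imsetP; exists k.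
by rewrite card_fibperms //; apply: eq_bigr => k _; rewrite card_fibperms1.
Qed.

Lemma fibsize_lift w q k : w \in Wrn r n ->
  fibsize [ffun i => q (wsig w i)] k = fibsize q k.
Proof.
move=> wW; rewrite /fibsize.
have -> : [set i | [ffun i => q (wsig w i)] i == k] = wsig w @^-1: [set i | q i == k].
  by apply/setP => i; rewrite !inE ffunE.
rewrite card_preimset //; exact: wsig_inj wW.
Qed.

(** Orbit counting: W(r, n) acts transitively on the labellings with fibre sizes [nu], and
    [card_lifts] counts the elements that carry [q0] to a given one. *)
Lemma card_Wrn_labellings (nu : K -> nat) : (\sum_k nu k)%N = n ->
  (#|Wrn r n| = #|[set q : {ffun 'I_n -> K} | [forall k, fibsize q k == nu k]]| *
               \prod_k #|Wrn r (nu k)|)%N.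
Proof.
move=> nun; set Q := [set q | _].
(* A base point is read off the word with [nu k] letters [k] for each label [k]. *)
have [q0 q0Q] : exists q0, q0 \in Q.
  pose l := flatten [seq nseq (nu k) k | k <- enum K].
  have szl : size l == n.
    rewrite size_flatten /shape -map_comp sumnE big_map -nun big_enum /=.
    by apply/eqP/eq_bigr => k _ /=; rewrite size_nseq.
  exists [ffun i => tnth (Tuple szl) i]; rewrite inE; apply/forallP => k.
  rewrite -count_labelling.
  have -> : [tuple [ffun i => tnth (Tuple szl) i] i | i < n] = Tuple szl.
    by apply: eq_from_tnth => i; rewrite tnth_mktuple ffunE.
  rewrite /= count_flatten -map_comp sumnE big_map big_enum /=.
  rewrite (bigD1 k) //= count_nseq /= eqxx mul1n big1 ?addn0 // => j /negPf nj.
  by rewrite count_nseq /= nj.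
have q0P k : fibsize q0 k = nu k by move: q0Q; rewrite inE => /forallP/(_ k)/eqP.
rewrite -sum1_card (partition_big (fun w => [ffun i => q0 (wsig w i)]) (mem Q)) /=; last first.
  by move=> w wW; rewrite inE; apply/forallP => k; rewrite fibsize_lift // q0P.
rewrite -sum_nat_const; apply: eq_bigr => q; rewrite inE => /forallP qP.
rewrite sum1_card -(eq_bigr _ (fun k _ => congr1 (fun m => #|Wrn r m|) (q0P k))).
rewrite -(@card_lifts q0 q) => [|k]; last by rewrite q0P; apply/eqP.
apply: eq_card => w; rewrite unfold_in; apply/andP/liftsP => -[wW].
  by move/eqP <-; split=> // x; rewrite ffunE Wrn_snd.
by move=> H; split=> //; apply/eqP/ffunP => i; rewrite ffunE; apply: (H (0, i)).
Qed.

End CountLabellings.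

(** * Return maps *)

Section ReturnMap.
Variables (r n : nat) (K J : finType) (s : K -> K) (t : J -> K).
Hypothesis trt : cycle_transversal s t.
Local Notation X := (mu r * 'I_n)%type.
Variable q : {ffun 'I_n -> K}.
Implicit Types (x : X) (w a : {perm X}).

Definition lifts_along : {set {perm X}} := lifts r [ffun i => s (q i)] q.
Let R := [set t j | j in J].

Lemma lifts_alongP w :
  reflect (w \in Wrn r n /\ forall x, q (w x).2 = s (q x.2)) (w \in lifts_along).
Proof.
apply: (iffP (liftsP _ _ _)) => -[wW H]; split=> // x; rewrite H ffunE //.
Qed.

Lemma label_iter w i x : w \in lifts_along -> q (iter i w x).2 = iter i s (q x.2).
Proof. by case/lifts_alongP => _ H; elim: i => //= i <-. Qed.

(** The return to the fibre over each representative, extended by the identity so as to lie in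
    [fibperms r q R]. *)
Let ret_fun w x := if q x.2 \in R then iter (fingraph.order s (q x.2)) w x else x.
Definition return_map w : {perm X} := perm_of_fun (ret_fun w).

Let injs : injective s. Proof. by case: trt. Qed.

Let ret_fun_q w x : w \in lifts_along -> q (ret_fun w x).2 = q x.2.
Proof.
by move=> wO; rewrite /ret_fun; case: ifP => // _; rewrite label_iter // iter_order.
Qed.

Let ret_fun_inj w : w \in lifts_along -> injective (ret_fun w).
Proof.
move=> wO x y e; have eq : q x.2 = q y.2 by rewrite -(ret_fun_q x wO) e ret_fun_q.
move: e; rewrite /ret_fun eq; case: ifP => // _.
by rewrite -!permX => /perm_inj.
Qed.

Lemma return_mapE w x : w \in lifts_along ->
  return_map w x = if q x.2 \in R then iter (fingraph.order s (q x.2)) w x else x.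
Proof. by move=> wO; rewrite [LHS]perm_of_funE //; apply: ret_fun_inj. Qed.

Lemma return_map_in w : w \in lifts_along -> return_map w \in fibperms r q R.
Proof.
move=> wO; apply/fibpermsP; split=> [|x|x nR].
- apply/Wrn_hom; split; first exact: (Bijective (permK _) (permKV _)).
  move=> x z; rewrite !return_mapE //=; case: ifP => // _.
  have /lifts_alongP[/Wrn_hom wW _] := wO.
  by have [_ H] := hom_iter (fingraph.order s (q x.2)) wW; apply: H.
- by rewrite return_mapE //; have := ret_fun_q x wO.
- by rewrite return_mapE // (negPf nR).
Qed.

Lemma lifts_alongM a w : a \in fibperms r q R -> w \in lifts_along -> (a * w)%g \in lifts_along.
Proof.
case/fibpermsP => aW aq _ /lifts_alongP[wW wq]; apply/lifts_alongP; split=> [|x].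
  exact: WrnM.
by rewrite permM wq aq.
Qed.

(** In [a * w] the factor [a] acts first. After the first step the orbit avoids the fibres over [R]
    until it returns, since a cycle of [s] contains only one representative; hence [a] intervenes
    exactly once. *)
Lemma return_mapM a w : a \in fibperms r q R -> w \in lifts_along ->
  return_map (a * w)%g = (a * return_map w)%g.
Proof.
move=> aA wO; have [aW aq aout] := fibpermsP _ _ _ aA.
have awO := lifts_alongM aA wO.
apply/permP => x; rewrite permM !return_mapE // aq.
case: ifP => [cR|/negbT cR]; last by rewrite aout.
have E i : (0 < i <= fingraph.order s (q x.2))%N -> iter i (a * w)%g x = iter i w (a x).
  elim: i => // -[_ _|i IH /andP[_ lt]]; first by rewrite /= permM.
  rewrite iterS IH ?(ltnW lt) // permM [RHS]iterS; congr (w _); apply: aout.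
  rewrite label_iter // aq; apply/imsetP => -[j' _].
  case/imsetP: cR lt => j _ -> lt e.
  have [ejj' e0] := @iter_transversal_inj _ _ _ _ trt j j' i.+1 0 lt (fingraph.order_gt0 _ _) e.
  by [].
by apply: E; rewrite fingraph.order_gt0 leqnn.
Qed.

(* Left multiplication by [fibperms q R] makes all fibres of the return map
   equinumerous. *)
Lemma sum_return_map (C : comPzSemiRingType) (f : {perm X} -> C) :
  #|fibperms r q R|%:R * \sum_(w in lifts_along) f (return_map w) =
  #|lifts_along|%:R * \sum_(a in fibperms r q R) f a.
Proof.
pose N := #|[set w in lifts_along | return_map w == 1%g]|.
have fibN a : a \in fibperms r q R -> #|[set w in lifts_along | return_map w == a]| = N.
  move=> aA.
  have [aW aq aout] := fibpermsP _ _ _ aA.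
  have aVA : (a^-1)%g \in fibperms r q R.
    apply/fibpermsP; split=> [|x|x nR]; first exact: WrnV.
      by rewrite -(aq (a^-1%g x)) permKV.
    by apply: (@perm_inj _ a); rewrite permKV aout.
  rewrite /N -[RHS](card_imset _ (mulgI a)); apply: eq_card => w.
  apply/idP/imsetP => [|[v]]; rewrite [X in is_true X -> _]in_set => /andP[vO /eqP e].
    exists (a^-1 * w)%g; last by rewrite mulKVg.
    by rewrite in_set lifts_alongM // return_mapM // e mulVg /=.
  move=> ->; rewrite in_set lifts_alongM //=.
  by rewrite return_mapM // e mulg1.
have sumE (g : {perm X} -> C) :
  \sum_(w in lifts_along) g (return_map w) = N%:R * \sum_(a in fibperms r q R) g a.
  rewrite (partition_big return_map (mem (fibperms r q R))) /=; last exact: return_map_in.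
  rewrite big_distrr /=; apply: eq_bigr => a aA.
  rewrite -(fibN a aA) (eq_bigr (fun _ => g a)) => [|w /andP[_ /eqP -> //]].
  rewrite -[LHS]big_set sumr_const mulr_natl; congr (_ *+ _).
(* Taking [g] constant equal to 1 expresses the number of lifts through [N], which eliminates
   [N]. *)
have /= cardE := sumE (fun _ => 1); rewrite !sumr_const in cardE.
by rewrite sumE cardE mulrA [_%:R * N%:R]mulrC.
Qed.

End ReturnMap.

Lemma Wrn1 r n : 1%g \in Wrn r n.
Proof. by rewrite inE; apply/forallP => x; apply/forallP => z; rewrite !perm1. Qed.

Lemma card_Wrn_neq0 (C : numDomainType) r n : #|Wrn r n|%:R != 0 :> C.
Proof. by rewrite pnatr_eq0 -lt0n; apply/card_gt0P; exists 1%g; apply: Wrn1. Qed.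

Lemma fibsize_along r n (K : finType) (s : K -> K) (q : {ffun 'I_n -> K})
    (w : {perm (mu r * 'I_n)}) k : injective s ->
  w \in lifts_along r s q -> fibsize q (s k) = fibsize q k.
Proof.
move=> injs /lifts_alongP[wW wq]; rewrite -[LHS](fibsize_lift _ _ wW).
apply: eq_card => i; rewrite !inE ffunE.
by rewrite -[wsig w i]/(w (0, i)).2 wq /= (inj_eq injs).
Qed.

(** * Averages of class functions over labellings and lifts *)

Section Core.
Variables (C : numFieldType) (r n : nat) (K J : finType) (s : K -> K) (t : J -> K).
Hypothesis trt : cycle_transversal s t.
Variables (nu : J -> nat) (H : J -> forall I : obj r, (I -> I) -> C).
Hypothesis Hconj : forall j, conj_invariant (H j).
Hypothesis Hcard : forall j (I : obj r) (f : I -> I), is_obj I -> is_hom f ->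
  H j f != 0 -> #|I| = (r.-1.+1 * nu j)%N.
Hypothesis nun : (\sum_j fingraph.order s (t j) * nu j)%N = n.

Let injs : injective s. Proof. by case: trt. Qed.
(** The size prescribed at the representative of the cycle of [k]; the sum has exactly one term. *)
Let nuK k := (\sum_(j | fconnect s (t j) k) nu j)%N.

Let nuK_rep j : nuK (t j) = nu j.
Proof.
rewrite /nuK (big_pred1 j) // => i /=; apply/idP/eqP => [|-> //].
by case: trt => _ _; apply.
Qed.

Let nuK_iter i k : nuK (iter i s k) = nuK k.
Proof.
elim: i => //= i <-; apply: eq_bigl => j; symmetry; exact: same_fconnect1_r.
Qed.

Let sum_nuK : (\sum_k nuK k)%N = n.
Proof.
rewrite (big_orbits trt) -nun; apply: eq_bigr => j _.
under eq_bigr do rewrite nuK_iter nuK_rep.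
by rewrite sum_nat_const card_ord.
Qed.

Let term q w := \prod_j H j (@rs r (nobj r n) (iter (fingraph.order s (t j)) w)
                                (fibre r q (t j))).

Let lifts_along_iter q w j : w \in lifts_along r s q ->
  is_hom (@rs r (nobj r n) (iter (fingraph.order s (t j)) w) (fibre r q (t j))).
Proof.
move=> wO; have /lifts_alongP[/Wrn_hom wW wq] := wO.
apply: hom_rs; [exact: hom_iter | exact: stable_fibre | ].
apply/eqP; rewrite eqEcard card_imset ?leqnn ?andbT; last exact: hom_inj (hom_iter _ wW).
apply/subsetP => y /imsetP[x]; rewrite !inE => /eqP e ->.
by rewrite (label_iter _ _ wO) e iter_order.
Qed.

(** By [Hcard] a nonzero factor forces the fibre size [nu j] at [t j], and fibre sizes are constant
    along the cycles of [s]. *)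
Let term_eq0 q w : w \in lifts_along r s q -> ~~ [forall k, fibsize q k == nuK k] -> term q w = 0.
Proof.
move=> wO; apply: contraNeq => /prodf_neq0 tn; apply/forallP => k.
have [j] : exists j, fconnect s (t j) k by case: trt.
move/iter_findex => <-; rewrite nuK_iter nuK_rep.
have -> : forall i, fibsize q (iter i s (t j)) = fibsize q (t j).
  by elim=> //= i <-; apply: fibsize_along injs wO.
have := Hcard _ (lifts_along_iter j wO) (tn j isT).
have -> : #|sobj (fibre r q (t j))| = #|fibre r q (t j)| by rewrite card_sig; apply: eq_card.
rewrite card_fibre => e; apply/eqP.
have/eqP := e (is_obj_sobj (is_obj_nobj _ _) (stable_fibre _ _ _)).
by rewrite eqn_pmul2l // => /eqP.
Qed.

(** The number of lifts is a product over all labels, the order of [fibperms] a product over the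
    representatives. Dividing by the latter in [sum_return_map] leaves one average per cycle. *)
Let sum_term q : [forall k, fibsize q k == nuK k] ->
  \sum_(w in lifts_along r s q) term q w =
  (\prod_k #|Wrn r (nuK k)|%:R) *
  \prod_j (#|Wrn r (nu j)|%:R^-1 * \sum_(u in Wrn r (nu j)) H j (I := nobj r (nu j)) u).
Proof.
move=> /forallP szq.
pose f (a : {perm (mu r * 'I_n)}) := \prod_j H j (@rs r (nobj r n) a (fibre r q (t j))).
have injt := transversal_inj trt.
have szt j : fibsize q (t j) = nu j by rewrite -nuK_rep; apply/eqP/szq.
have cardO : #|lifts_along r s q|%:R = \prod_k #|Wrn r (nuK k)|%:R :> C.
  rewrite -natr_prod card_lifts => [|k].
    by congr (_%:R); apply: eq_bigr => k _; rewrite (eqP (szq k)).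
  have sB : {on [pred i | true], bijective s} by apply/onW_bij/injF_bij.
  have [s' sK s'K] := injF_bij injs.
  have -> : fibsize [ffun i => s (q i)] k = fibsize q (s' k).
    by apply: eq_card => i; rewrite !inE ffunE (can2_eq sK s'K).
  by rewrite (eqP (szq _)) (eqP (szq _)) -[in RHS](s'K k) (nuK_iter 1).
have cardA : #|fibperms r q [set t j | j in J]|%:R = \prod_j #|Wrn r (nu j)|%:R :> C.
  rewrite card_fibperms // natr_prod; apply: eq_bigr => j _.
  by rewrite card_fibperms1 szt.
have An0 : \prod_j #|Wrn r (nu j)|%:R != 0 :> C.
  by apply/prodf_neq0 => j _; apply: card_Wrn_neq0.
apply: (mulfI An0); rewrite -{1}cardA.
have -> : \sum_(w in lifts_along r s q) term q w =
          \sum_(w in lifts_along r s q) f (return_map s t q w).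
  apply: eq_bigr => w wO; apply: eq_bigr => j _; congr (H j _).
  apply: functional_extensionality => p; congr insubd.
  have /eqP e : q (val p).2 == t j by have := valP p; rewrite inE.
  by rewrite return_mapE // e imset_f.
rewrite sum_return_map // cardO mulrCA; congr (_ * _).
rewrite sum_fibperms //; last first.
  move=> j a b e; congr (H j _); apply: functional_extensionality => p; congr insubd.
  by apply: e; have := valP p; rewrite inE => /eqP.
rewrite -big_split /=; apply: eq_bigr => j _.
rewrite mulVKf ?card_Wrn_neq0 // (@sum_fibperms1 _ _ _ _ _ _ (@H j)) //.
by rewrite szt.
Qed.

(** Every labelling with fibre sizes [nuK] contributes the same amount, and by [card_Wrn_labellings]
    their number times the product of the orders of the W(r, [nuK k]) is the order of W(r, n). *)
Lemma sum_labellings :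
  \sum_(q : {ffun 'I_n -> K}) \sum_(w in lifts_along r s q)
     \prod_j H j (@rs r (nobj r n) (iter (fingraph.order s (t j)) w) (fibre r q (t j)))
  = #|Wrn r n|%:R *
  \prod_j (#|Wrn r (nu j)|%:R^-1 * \sum_(u in Wrn r (nu j)) H j (I := nobj r (nu j)) u).
Proof.
rewrite (card_Wrn_labellings r sum_nuK) natrM natr_prod -mulrA mulr_natl -sumr_const.
rewrite (bigID (fun q : {ffun 'I_n -> K} => [forall k, fibsize q k == nuK k])) /=.
rewrite [X in _ + X]big1 ?addr0 => [|q nq]; last first.
  by apply: big1 => w wO; apply: term_eq0.
apply: eq_big => [q|q szq]; first by rewrite inE.
exact: sum_term.
Qed.

End Core.

(** * Cycle counts *)

Lemma iter_order_dvd (K : finType) (s : K -> K) (c : K) i : injective s ->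
  (iter i s c == c) = (fingraph.order s c %| i)%N.
Proof.
move=> injs; set d := fingraph.order s c.
have iterd k : iter (k * d) s c = c.
  by elim: k => // k IH; rewrite mulSn iterD IH iter_order.
rewrite {1}(divn_eq i d) addnC iterD iterd /dvdn; apply/eqP/eqP => [e|->//].
by rewrite -(findex_iter (ltn_pmod i (fingraph.order_gt0 s c))) e findex0.
Qed.

Section CycleCount.
Variable r : nat.

(* [p] lies on a cycle of [f] modulo mu_r of length [m] and type [z]. *)
Definition on_cycle (I : obj r) (f : I -> I) (m : nat) (z : mu r) (p : I) : bool :=
  (iter m f p == Defs.act I p z) &&
  [forall i : 'I_m, (0 < i)%N ==> [forall z', iter i f p != Defs.act I p z']].

Definition cycle_points (I : obj r) (f : I -> I) m z := #|[set p | on_cycle f m z p]|.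

(* The multiplicity a_(j+1)(z): each cycle of length j+1 is covered by r(j+1) points. *)
Definition cycle_mult (j : nat) (z : mu r) (I : obj r) (f : I -> I) : nat :=
  (cycle_points f j.+1 z %/ (r.-1.+1 * j.+1))%N.

Lemma cycle_points_conj m z : conj_invariant (fun I f => @cycle_points I f m z).
Proof.
move=> I J f g h oI oJ hf hg hh fgh.
have fi i p : f (iter i g p) = iter i h (f p) by elim: i => //= i <-.
have injf := hom_inj hf; case: (hf) => bf af.
rewrite /cycle_points -[LHS](card_imset _ injf); apply: eq_card => p.
have [f' fK f'K] := bf; rewrite -[p]f'K (mem_imset _ _ injf) !inE.
set p' := f' p; rewrite /on_cycle -fi -af (inj_eq injf); congr (_ && _).
by apply: eq_forallb => i; congr (_ ==> _); apply: eq_forallb => z'; rewrite -fi -af (inj_eq injf).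
Qed.

Lemma cycle_mult_conj j z : conj_invariant (cycle_mult j z).
Proof.
move=> I J f g h oI oJ hf hg hh fgh; congr (_ %/ _)%N.
exact: (cycle_points_conj _ _ oI oJ hf).
Qed.

Section Standard.
Variables (n : nat) (w : {perm (mu r * 'I_n)}).
Hypothesis wW : w \in Wrn r n.

Lemma iter_Wrn i z k : iter i w (z, k) = ((iter i w (0, k)).1 + z, iter i (wsig w) k).
Proof.
elim: i => [|i IH] /=; first by rewrite add0r.
rewrite IH [in LHS]WrnE // [in RHS](surjective_pairing (iter i w (0, k))).
have -> : (iter i w (0, k)).2 = iter i (wsig w) k.
  by elim: i {IH} => //= i IH; rewrite Wrn_snd // IH.
by rewrite [in RHS]WrnE //= addrA.
Qed.

(** Translation of the first coordinate by [x] commutes with [w], so the type read at the base point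
    [(0, k)] holds at every point over [k]. *)
Lemma on_cycle_Wrn m z x k :
  on_cycle (I := nobj r n) w m.+1 z (x, k) = (wlen w k == m.+1) && (wtyp w k == z).
Proof.
have injw := wsig_inj wW.
have acte i z' : (iter i w (x, k) == Defs.act (nobj r n) (x, k) z') =
   (wlen w k %| i)%N && ((iter i w (0, k)).1 == z').
  rewrite iter_Wrn /= -[LHS]/((_ == _) && (_ == _)) /= addrC (inj_eq (addrI _)) andbC.
  by rewrite iter_order_dvd.
rewrite /on_cycle acte; apply/andP/andP => [[/andP[dv /eqP e] /forallP H]|[/eqP d /eqP e]].
  suff d : wlen w k == m.+1 by split=> //; rewrite /wtyp (eqP d) e.
  rewrite eqn_leq dvdn_leq //= leqNgt; apply/negP => lt.
  have /= := H (Ordinal lt); rewrite fingraph.order_gt0 /= => /forallP/(_ (wtyp w k)).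
  by rewrite acte dvdnn eqxx.
split; first by rewrite d dvdnn -e /wtyp d /=.
apply/forallP => i; apply/implyP => i0; apply/forallP => z'; rewrite acte d.
by rewrite gtnNdvd.
Qed.

Lemma cycle_points_Wrn m z :
  cycle_points (I := nobj r n) w m.+1 z =
  (r.-1.+1 * #|[set k | (wlen w k == m.+1) && (wtyp w k == z)]|)%N.
Proof.
rewrite /cycle_points -[X in (X * _)%N]card_ord -cardsT -cardsX; apply: eq_card => -[x k].
by rewrite !inE on_cycle_Wrn.
Qed.

Lemma wlen_wsig k : wlen w (wsig w k) = wlen w k.
Proof.
apply/eq_card => y; rewrite !inE -[LHS]/(fconnect _ _ _) -[RHS]/(fconnect _ _ _).
by rewrite -same_fconnect1 //; exact: wsig_inj.
Qed.

(** Since [w] commutes with its powers, the [m]-th iterate at [w (0, k)] is the image under [w] of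
    the [m]-th iterate at [(0, k)]; comparing first coordinates in the commutative group gives the
    claim. *)
Lemma wtyp_wsig k : wtyp w (wsig w k) = wtyp w k.
Proof.
have injw := wsig_inj wW.
rewrite /wtyp wlen_wsig; set m := wlen w k.
have e : w (0, k) = ((w (0, k)).1, wsig w k) by rewrite /wsig; case: (w (0, k)).
have iterm : iter m w (0, k) = ((iter m w (0, k)).1, k).
  by rewrite {1}iter_Wrn iter_order // addr0.
have := iter_Wrn m (w (0, k)).1 (wsig w k); rewrite -e -iterSr iterS iterm.
rewrite WrnE // => /(congr1 fst) /=; rewrite addrC => /addIr e1.
exact: esym e1.
Qed.

Lemma dvdn_cycle_count m z :
  (m.+1 %| #|[set k | (wlen w k == m.+1) && (wtyp w k == z)]|)%N.
Proof.
have injw := wsig_inj wW; set A := [set k | _].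
rewrite -(@fcard_order_set _ _ injw m.+1 (mem A)) ?dvdn_mull //.
  by apply/subsetP => k; rewrite !inE => /andP[].
apply: intro_closed => [k l|k l /eqP <-]; first exact: fconnect_sym.
by rewrite !inE wlen_wsig wtyp_wsig.
Qed.

Lemma wlen_le k : (wlen w k <= n)%N.
Proof. by rewrite -[X in (_ <= X)%N](card_ord n) max_card. Qed.

Lemma cycle_multE m z :
  (cycle_mult m z (I := nobj r n) w * m.+1)%N =
  #|[set k | (wlen w k == m.+1) && (wtyp w k == z)]|.
Proof. by rewrite /cycle_mult cycle_points_Wrn divnMl // divnK // dvdn_cycle_count. Qed.

Lemma cycle_points_mult m z :
  cycle_points (I := nobj r n) w m.+1 z =
  (r.-1.+1 * m.+1 * cycle_mult m z (I := nobj r n) w)%N.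
Proof. by rewrite cycle_points_Wrn -cycle_multE -mulnA [(m.+1 * _)%N]mulnC. Qed.

Lemma cycle_mult_ge m z : (n <= m)%N -> cycle_mult m z (I := nobj r n) w = 0%N.
Proof.
move=> le; apply/eqP; rewrite -(eqn_pmul2r (ltn0Sn m)) mul0n cycle_multE cards_eq0.
apply/eqP/setP => k; rewrite !inE; apply/negP => /andP[/eqP e _].
by have := wlen_le k; rewrite e ltnNge le.
Qed.

Lemma wmonoE x : wmono w x = cycle_mult x.1 x.2 (I := nobj r n) w :> nat.
Proof.
rewrite ffunE -cycle_multE mulnK // inordK // ltnS.
apply: leq_trans (leq_pmulr _ (ltn0Sn x.1)) _; rewrite cycle_multE.
by rewrite -[X in (_ <= X)%N](card_ord n) max_card.
Qed.

Lemma sum_cycle_mult N : (n <= N)%N ->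
  (\sum_(x : 'I_N * mu r) x.1.+1 * cycle_mult x.1 x.2 (I := nobj r n) w = n)%N.
Proof.
move=> nN; rewrite -[RHS]card_ord -sum1_card.
have ltw k : ((wlen w k).-1 < N)%N.
  by apply: leq_trans nN; rewrite prednK ?wlen_le // fingraph.order_gt0.
rewrite (partition_big (fun k => (Ordinal (ltw k), wtyp w k)) predT) //=.
apply: eq_bigr => -[j z] _; rewrite mulnC cycle_multE sum1dep_card; apply: eq_card => k.
rewrite !inE -[RHS]/((_ == _) && (_ == _)) /=.
congr (_ && _); rewrite -[RHS]/((wlen w k).-1.+1 == j.+1) prednK //.
exact: fingraph.order_gt0.
Qed.

End Standard.

Lemma mweight_wmono n (w : {perm (mu r * 'I_n)}) : w \in Wrn r n -> mweight (wmono w) = n.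
Proof.
move=> wW; rewrite -[RHS](sum_cycle_mult wW (leqnn n)); apply: eq_bigr => x _.
by rewrite wmonoE.
Qed.

End CycleCount.

(** * Reduction of free objects to the standard ones *)

Section Standardization.
Variable r : nat.

(** A free object is a disjoint union of regular orbits; a chosen representative of each orbit
    provides the coordinates [(z, i)]. *)
Lemma exists_nobj_iso (I : obj r) : is_obj I ->
  exists n (f : nobj r n -> I), is_hom f.
Proof.
case=> a0 aD aF.
pose e x y := [exists z, Defs.act I x z == y].
have exx x : e x x by apply/existsP; exists 0; rewrite a0.
have etr x y u : e x y -> e x u = e y u.
  case/existsP => z /eqP <-; apply/existsP/existsP => -[z' /eqP <-].
    by exists (z' - z); rewrite aD addrC subrK.
  by exists (z + z'); rewrite aD.
pose rep x := odflt x [pick y | e x y].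
have erep x : e x (rep x) by rewrite /rep; case: pickP => [|/(_ x)] //=; rewrite exx.
(* [pick] depends only on the extension of its predicate, so the representative depends on the orbit
   alone. *)
have repE x y : e x y -> rep x = rep y.
  move=> exy; rewrite /rep (eq_pick (etr x y ^~ exy)); case: pickP => // /(_ y).
  by rewrite exx.
pose T := [set x | rep x == x].
exists #|T|, (fun p : nobj r #|T| => Defs.act I (enum_val p.2) p.1).
have rT (i : 'I_#|T|) : rep (enum_val i) = enum_val i.
  by have := enum_valP i; rewrite inE => /eqP.
split; last by move=> [z i] z' /=; rewrite aD.
pose cand x := odflt 0 [pick z | Defs.act I (rep x) z == x].
have repT x : rep x \in T by rewrite inE -(repE _ _ (erep x)).
exists (fun x => (cand x, enum_rank_in (repT x) (rep x))) => [[z i]|x] /=.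
  have ri : rep (Defs.act I (enum_val i) z) = enum_val i.
    by rewrite -[RHS]rT; apply/esym/repE/existsP; exists z.
  congr pair; last by apply: enum_val_inj; rewrite enum_rankK_in ?repT // ri.
  rewrite /cand ri; case: pickP => [z' /eqP ez|/(_ z)]; last by rewrite eqxx.
  apply/eqP; rewrite -subr_eq0; apply/eqP; apply: (aF (enum_val i)).
  by rewrite -aD ez aD subrr a0.
rewrite enum_rankK_in //; rewrite /cand; case: pickP => [z /eqP //|H].
have /existsP[z /eqP ez] := erep x.
by have := H (- z); rewrite -ez aD subrr a0 eqxx.
Qed.

(** [H] is quantified inside so that one [w] serves several class functions at once, such as
    [cycle_points] and [cycle_mult]. *)
Lemma standardize (I : obj r) (f : I -> I) : is_obj I -> is_hom f ->
  exists n (w : {perm (mu r * 'I_n)}),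
    [/\ w \in Wrn r n, #|I| = (r.-1.+1 * n)%N
      & forall (C : Type) (H : forall I : obj r, (I -> I) -> C), conj_invariant H ->
          H I f = H (nobj r n) w].
Proof.
move=> oI hf; have [n [phi hphi]] := exists_nobj_iso oI.
have [psi [hpsi phiK psiK]] := hom_inv hphi.
have hw := hom_comp (hom_comp hphi hf) hpsi.
pose w := perm (hom_inj hw).
have wE : w =1 psi \o (f \o phi) by move=> x; rewrite permE.
have wW : w \in Wrn r n.
  apply/Wrn_hom; split; first exact: (Bijective (permK _) (permKV _)).
  by move=> x z; rewrite !wE; have [_ ->] := hw.
exists n, w; split=> // [|C H cH].
  by case: hphi => /bij_eq_card <- _; rewrite card_prod !card_ord.
apply: (cH _ _ psi) => //; [exact: is_obj_nobj | exact/Wrn_hom |].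
by move=> x; rewrite wE /= psiK.
Qed.

Section General.
Variables (I : obj r) (f : I -> I).
Hypotheses (oI : is_obj I) (hf : is_hom f).

Lemma cycle_points_multE m z :
  cycle_points f m.+1 z = (r.-1.+1 * m.+1 * cycle_mult m z f)%N.
Proof.
have [n [w [wW _ wH]]] := standardize oI hf.
rewrite (wH _ _ (@cycle_points_conj r m.+1 z)) (wH _ _ (@cycle_mult_conj r m z)).
exact: cycle_points_mult.
Qed.

Lemma sum_cycle_multE N k : #|I| = (r.-1.+1 * k)%N -> (k <= N)%N ->
  (\sum_(x : 'I_N * mu r) x.1.+1 * cycle_mult x.1 x.2 f = k)%N.
Proof.
have [n [w [wW cI wH]]] := standardize oI hf.
rewrite cI => /eqP; rewrite eqn_pmul2l // => /eqP <- nN.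
rewrite -[RHS](sum_cycle_mult wW nN); apply: eq_bigr => x _.
by rewrite (wH _ _ (@cycle_mult_conj r _ _)).
Qed.

End General.
End Standardization.

Section CycleMultLifts.
Variables (r n : nat) (K J : finType) (s : K -> K) (t : J -> K).
Hypothesis trt : cycle_transversal s t.
Variables (q : {ffun 'I_n -> K}) (w : {perm (mu r * 'I_n)}).
Hypothesis wO : w \in lifts_along r s q.
Local Notation X := (mu r * 'I_n)%type.

Let injs : injective s. Proof. by case: trt. Qed.
Let hw : is_hom (I := nobj r n) (J := nobj r n) w.
Proof. by apply/Wrn_hom; case/lifts_alongP: wO. Qed.

Lemma imset_iter_fibre k :
  [set iter (fingraph.order s k) w x | x in fibre r q k] = fibre r q k.
Proof.
apply/eqP; rewrite eqEcard card_imset ?leqnn ?andbT; last exact: hom_inj (hom_iter _ hw).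
apply/subsetP => y /imsetP[x]; rewrite !inE => /eqP e ->.
by rewrite (label_iter _ _ wO) e iter_order.
Qed.

Lemma hom_rs_iter k : is_hom (@rs r (nobj r n) (iter (fingraph.order s k) w) (fibre r q k)).
Proof.
by apply: hom_rs; [exact: hom_iter | exact: stable_fibre | exact: imset_iter_fibre].
Qed.

(** An iterate of [w] that returns to the orbit of [p] also returns to the label [k], so its
    exponent is a multiple of the cycle length of [k]; these multiples are the iterates of the
    return map. *)
Lemma on_cycle_rs m z k (p : sobj (fibre r q k)) : (0 < m)%N ->
  on_cycle (I := nobj r n) w m z (val p) =
  (fingraph.order s k %| m)%N &&
  on_cycle (@rs r (nobj r n) (iter (fingraph.order s k) w) (fibre r q k))
     (m %/ fingraph.order s k) z p.
Proof.
set d := fingraph.order s k => m0.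
have d0 : (0 < d)%N := fingraph.order_gt0 s k.
have qp : q (val p).2 = k by have := valP p; rewrite inE => /eqP.
have dvd i z' : iter i w (val p) = Defs.act (nobj r n) (val p) z' -> (d %| i)%N.
  move=> e; rewrite -iter_order_dvd //; apply/eqP.
  by rewrite -{1}qp -(label_iter _ _ wO) e /= qp.
have acte i z' : (iter (i * d) w (val p) == Defs.act (nobj r n) (val p) z') =
  (iter i (@rs r (nobj r n) (iter d w) (fibre r q k)) p == Defs.act (sobj (fibre r q k)) p z').
  rewrite -[RHS](inj_eq val_inj) val_act_sobj ?stable_fibre //; congr (_ == _).
  elim: i => [//|i IH]; rewrite mulSn iterD IH iterS val_rs //.
  exact: imset_iter_fibre.
have [dm|ndm] := boolP (d %| m)%N; last first.
  by apply/negP => /andP[/eqP/dvd dm _]; rewrite dm in ndm.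
rewrite andTb /on_cycle -acte divnK //; congr (_ && _).
apply/forallP/forallP => H i; apply/implyP => i0; apply/forallP => z'.
  have lt : (i * d < m)%N by rewrite -ltn_divRL.
  have /implyP/= := H (Ordinal lt); rewrite muln_gt0 i0 d0 => /(_ isT)/forallP/(_ z').
  by rewrite acte.
apply/negP => /eqP e; have di := dvd _ _ e.
have lt : (i %/ d < m %/ d)%N by rewrite ltn_divRL // divnK.
have /implyP/= := H (Ordinal lt); rewrite divn_gt0 // dvdn_leq // => /(_ isT)/forallP/(_ z').
by rewrite -acte divnK // e eqxx.
Qed.

(* A cycle of length [m] of [w] runs through the fibres over one cycle of [s], of
   length [d | m]; the return map to one of these fibres has a cycle of length [m / d]
   and the same type. *)
Lemma cycle_mult_lifts m z :
  cycle_mult m z (I := nobj r n) w =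
  (\sum_j if fingraph.order s (t j) %| m.+1 then
      cycle_mult (m.+1 %/ fingraph.order s (t j)).-1 z
        (@rs r (nobj r n) (iter (fingraph.order s (t j)) w) (fibre r q (t j)))
    else 0)%N.
Proof.
have c0 : (0 < r.-1.+1 * m.+1)%N by [].
apply/eqP; rewrite -(eqn_pmul2l c0) -cycle_points_multE //; last exact: is_obj_nobj.
(* The points are sorted by label. As [w] carries those over [k] bijectively to those over [s k],
   one fibre per cycle of [s] suffices. *)
rewrite /cycle_points -sum1_card (partition_big (fun p : X => q p.2) predT) //=.
pose T k := #|[set p in fibre r q k | on_cycle (I := nobj r n) w m.+1 z p]|.
rewrite (eq_bigr T) => [|k _]; last first.
  by rewrite sum1dep_card; apply: eq_card => p; rewrite !inE andbC.
have Ts k : T (s k) = T k.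
  rewrite /T -[RHS](card_imset _ (@perm_inj _ w)); apply: eq_card => p.
  rewrite -[p](permKV w) (mem_imset _ _ (@perm_inj _ w)) !inE; set p' := (w^-1)%g p.
  have /lifts_alongP[_ ->] := wO; rewrite (inj_eq injs); congr (_ && _).
  have E i z' : (iter i w (w p') == Defs.act (nobj r n) (w p') z') =
                (iter i w p' == Defs.act (nobj r n) p' z').
    by rewrite -iterSr; case: hw => bw aw; rewrite -aw (inj_eq (hom_inj hw)).
  rewrite /on_cycle E; congr (_ && _); apply: eq_forallb => i; congr (_ ==> _).
  by apply: eq_forallb => z'; rewrite E.
rewrite (big_orbits trt) big_distrr /=; apply/eqP/eq_bigr => j _.
set d := fingraph.order s (t j).
have -> : (\sum_(i < d) T (iter i s (t j)) = d * T (t j))%N.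
  rewrite (eq_bigr (fun _ => T (t j))) ?sum_nat_const ?card_ord // => i _.
  by elim: (i : nat) => //= k <-.
have -> : T (t j) = #|[set p | on_cycle (I := nobj r n) w m.+1 z (val (p : sobj (fibre r q (t j))))]|.
  rewrite /T -[RHS](card_imset _ val_inj); apply: eq_card => p; rewrite [LHS]inE.
  apply/andP/imsetP => [[pF pc]|[p' + ->]]; first by exists (Sub p pF); rewrite ?inE.
  by rewrite inE => pc; split=> //; apply: valP.
have [dm|ndm] := boolP (d %| m.+1)%N; last first.
  rewrite (_ : #|_| = 0%N) ?muln0 //; apply: eq_card0 => p.
  by rewrite inE on_cycle_rs // -/d (negPf ndm).
have e0 : (0 < m.+1 %/ d)%N by rewrite divn_gt0 ?fingraph.order_gt0 // dvdn_leq.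
rewrite (_ : #|_| = cycle_points (@rs r (nobj r n) (iter d w) (fibre r q (t j))) (m.+1 %/ d).-1.+1 z).
  rewrite cycle_points_multE; [|exact: is_obj_sobj (is_obj_nobj _ _) (stable_fibre _ _ _)|exact: hom_rs_iter].
  move: (cycle_mult _ _ _) => c.
  by rewrite (prednK e0) -[X in (_ = _ * X * _)%N](divnK dm) mulnA [(d * _)%N]mulnC -!mulnA.
by rewrite (prednK e0); apply: eq_card => p; rewrite !inE on_cycle_rs // -/d dm.
Qed.

End CycleMultLifts.

Lemma card_Wrn r n : (0 < r)%N -> #|Wrn r n| = (r ^ n * n`!)%N.
Proof.
move=> r0; pose h (u : {ffun 'I_n -> mu r} * 'S_n) (x : mu r * 'I_n) := (u.1 x.2 + x.1, u.2 x.2).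
have injh u : injective (h u).
  by move=> [z i] [z' j] e; have /= /perm_inj ij := congr1 snd e;
     move: e; rewrite -ij => /(congr1 fst) /= /addrI ->.
have hE u x : perm (@injh u) x = h u x by rewrite permE.
have -> : Wrn r n = [set perm (@injh u) | u in [set: {ffun 'I_n -> mu r} * 'S_n]].
  apply/setP => w; apply/idP/imsetP => [wW|[u _ ->]]; last first.
    apply/Wrn_hom; split; first exact: (Bijective (permK _) (permKV _)).
    by move=> x z; rewrite !hE /h /= addrA.
  exists ([ffun i => (w (0, i)).1], perm (wsig_inj wW)); rewrite ?inE //.
  by apply/permP => -[z i]; rewrite hE /h /= ffunE permE WrnE.
rewrite card_imset; last first.
  move=> u v e; have E x : h u x = h v x by rewrite -!hE e.
  have e2 i : u.2 i = v.2 i := congr1 snd (E (0, i)).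
  have e1 i : u.1 i = v.1 i by have := congr1 fst (E (0, i)); rewrite /= !addr0.
  by case: u v e1 e2 {e E} => u1 u2 [v1 v2] /= e1 e2; congr pair; [apply/ffunP|apply/permP].
by rewrite cardsT card_prod card_ffun card_Sn !card_ord prednK.
Qed.

(** * Monomial components of the characteristic *)

Section MonomialPart.
Variables (C : numClosedFieldType) (r : nat) (V : rmod C r).
Hypotheses (r0 : (0 < r)%N) (modV : is_mod V).

(** The exponents of [b] see only cycle lengths up to [N]. The size condition rules out longer
    cycles and provides the support hypothesis [Hcard] of [sum_labellings]. *)
Definition monomial_trace N (b : Mono r N) (I : obj r) (f : I -> I) : C :=
  ([forall x : 'I_N * mu r, cycle_mult x.1 x.2 f == b x] &&
   (#|I| == r.-1.+1 * mweight b)%N)%:R * trm V f.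

Lemma monomial_trace_conj N (b : Mono r N) : conj_invariant (monomial_trace b).
Proof.
move=> I J f g h oI oJ hf hg hh fgh; congr (_%:R * _); last exact: (trm_conj modV oI oJ hf).
have -> : #|I| = #|J| by case: hf => /bij_eq_card.
congr (nat_of_bool (_ && _)); apply: eq_forallb => x.
by rewrite (@cycle_mult_conj r _ _ _ _ f g h oI oJ hf hg hh fgh).
Qed.

Lemma mweight_ge N (b : Mono r N) (x : 'I_N * mu r) : (x.1.+1 * b x <= mweight b)%N.
Proof. by rewrite /mweight (bigD1 x) //= leq_addr. Qed.

(** This presents a coefficient of ch(V) as the average of a class function, the form that occurs in
    [sum_labellings]. [resize] loses nothing: an exponent can be nonzero only at a length not
    exceeding the weight. *)
Lemma scoef_ch N (b : Mono r N) : (mweight b <= N)%N ->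
  scoef (ch V) b = #|Wrn r (mweight b)|%:R^-1 *
   \sum_(u in Wrn r (mweight b)) monomial_trace b (I := nobj r (mweight b)) u.
Proof.
move=> wN; rewrite /scoef /ch card_Wrn //; congr (_ * _).
rewrite big_mkcondr; apply: eq_bigr => u uW; rewrite /monomial_trace.
rewrite card_prod !card_ord eqxx andbT -/(trm V (I := nobj r _) u).
suff -> : (wmono u == resize (mweight b) b) =
   [forall x : 'I_N * mu r, cycle_mult x.1 x.2 (I := nobj r (mweight b)) u == b x].
  by case: ifP; rewrite ?mul1r ?mul0r.
set m := mweight b in u uW wN *.
have resE x : (resize m b x = b (widen_ord wN x.1, x.2) :> nat)%N.
  have -> : resize m b x = inord (b (widen_ord wN x.1, x.2)).
    rewrite ffunE /expo; have lt := leq_trans (ltn_ord x.1) wN.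
    by rewrite insubT /=; congr (inord (b (_, _))); apply: val_inj.
  rewrite inordK // ltnS; apply: leq_trans (mweight_ge b (widen_ord wN x.1, x.2)).
  by rewrite leq_pmull.
apply/eqP/forallP => [e [j z]|H]; last first.
  apply/ffunP => x; apply: val_inj; rewrite /= resE wmonoE //.
  by have /eqP := H (widen_ord wN x.1, x.2).
have [lt|ge] := ltnP j m.
  have := congr1 (fun b' : Mono r m => nat_of_ord (b' (Ordinal lt, z))) e.
  rewrite /= resE wmonoE //= => ->; apply/eqP; congr (nat_of_ord (b (_, _))).
  exact: val_inj.
rewrite cycle_mult_ge //= eq_sym; have := mweight_ge b (j, z); rewrite -/m /=.
case: (nat_of_ord (b _)) => // k; rewrite mulnS => /(leq_trans (leq_addr _ _)) lt.
by have := leq_trans lt ge; rewrite ltnn.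
Qed.

Section Insert.
Variables (n : nat) (K J : finType) (s : K -> K) (t : J -> K) (d : J -> nat).
Hypotheses (trt : cycle_transversal s t) (dE : forall j, d j = fingraph.order s (t j)).
Variable a : Mono r n.

Let injs : injective s. Proof. by case: trt. Qed.

Definition surjlab (q : {ffun 'I_n -> K}) := [forall k, (0 < fibsize q k)%N].
(** The range of the inner sum in [pleth], for the parts [d j]. *)
Definition admissible (b : {ffun J -> Mono r n}) :=
  [&& [forall j, (0 < mweight (b j))%N], (\sum_j d j * mweight (b j))%N == n
    & [forall x : 'I_n * mu r, (\sum_j sexpo (d j) (b j) x.1 x.2)%N == a x]].

(** A single tuple survives, the cycle monomials [bq] of the return maps. Its weights are fibre
    sizes, so their positivity is surjectivity of [q] and their total with multiplicities [d j] is
    [n]; by [cycle_mult_lifts] its substituted product is the monomial of [w]. *)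
Lemma sum_monomial_trace (q : {ffun 'I_n -> K}) (w : {perm (mu r * 'I_n)}) :
  w \in lifts_along r s q ->
  \sum_(b : {ffun J -> Mono r n} | admissible b)
     \prod_j monomial_trace (b j) (@rs r (nobj r n) (iter (d j) w) (fibre r q (t j)))
  = (surjlab q && (wmono w == a))%:R *
    \prod_j trm V (@rs r (nobj r n) (iter (d j) w) (fibre r q (t j))).
Proof.
move=> wO; pose f j := @rs r (nobj r n) (iter (d j) w) (fibre r q (t j)).
have wW : w \in Wrn r n by case/lifts_alongP: wO.
have oF j : is_obj (sobj (fibre r q (t j))).
  exact: is_obj_sobj (is_obj_nobj _ _) (stable_fibre _ _ _).
have hf j : is_hom (f j) by rewrite /f dE; apply: (hom_rs_iter trt wO).
have cF j : #|sobj (fibre r q (t j))| = (r.-1.+1 * fibsize q (t j))%N.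
  by rewrite -card_fibre card_sig; apply: eq_card.
have fibn k : (fibsize q k <= n)%N by rewrite -[X in (_ <= X)%N](card_ord n) max_card.
have sumf j := sum_cycle_multE (oF j) (hf j) (cF j) (fibn (t j)).
pose bq : {ffun J -> Mono r n} := [ffun j => [ffun x : 'I_n * mu r => inord (cycle_mult x.1 x.2 (f j))]].
have bqE j (x : 'I_n * mu r) : bq j x = cycle_mult x.1 x.2 (f j) :> nat.
  rewrite !ffunE inordK // ltnS; apply: leq_trans (fibn (t j)).
  rewrite -(sumf j) (bigD1 x) //=; apply: leq_trans (leq_addr _ _).
  by rewrite leq_pmull.
have wbq j : mweight (bq j) = fibsize q (t j).
  by rewrite -(sumf j); apply: eq_bigr => x _; rewrite bqE.
have mtE (b : {ffun J -> Mono r n}) : \prod_j monomial_trace (b j) (f j) =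
    (b == bq)%:R * \prod_j trm V (f j).
  have [->|nb] := eqVneq b bq.
    rewrite mul1r; apply: eq_bigr => j _; rewrite /monomial_trace wbq cF eqxx andbT.
    by rewrite (_ : [forall x, _]) ?mul1r //; apply/forallP => x; rewrite bqE.
  rewrite mul0r; have [j nj] : exists j, b j != bq j.
    apply/existsP; rewrite -negb_forall; apply: contra nb => /forallP H.
    by apply/eqP/ffunP => j; apply/eqP/H.
  rewrite (bigD1 j) //= {1}/monomial_trace (_ : [forall x, _] = false) ?mul0r ?mul0r //.
  apply: contraNF nj => /forallP H; apply/eqP/ffunP => x; apply: val_inj => /=.
  by rewrite bqE; apply/esym/eqP/H.
rewrite (eq_bigr _ (fun b _ => mtE b)).
rewrite -big_distrl /=; congr (_ * _).
transitivity ((admissible bq)%:R : C).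
  rewrite big_mkcond (bigD1 bq) //= eqxx big1 ?addr0 => [|b /negPf nb]; first by case: ifP.
  by rewrite nb; case: ifP.
have sizes k : exists2 j, fconnect s (t j) k & fibsize q k = fibsize q (t j).
  have [j cj] : exists j, fconnect s (t j) k by case: trt.
  exists j => //; move/iter_findex: cj => <-.
  by elim: (findex _ _ _) => //= i <-; apply: fibsize_along injs wO.
congr (nat_of_bool _)%:R; rewrite /admissible; congr andb.
  apply/forallP/forallP => H k; last by rewrite wbq.
  by have [j _ ->] := sizes k; rewrite -wbq.
have -> : (\sum_j d j * mweight (bq j))%N == n.
  apply/eqP; transitivity (\sum_k fibsize q k)%N.
    rewrite (big_orbits trt); apply: eq_bigr => j _; rewrite wbq dE.
    rewrite (eq_bigr (fun _ => fibsize q (t j))) ?sum_nat_const ?card_ord // => i _.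
    by elim: (i : nat) => //= k <-; apply: fibsize_along injs wO.
  rewrite -[RHS]card_ord -sum1_card (partition_big q predT) //=.
  by apply: eq_bigr => k _; rewrite sum1dep_card.
have E (x : 'I_n * mu r) : (\sum_j sexpo (d j) (bq j) x.1 x.2)%N = wmono w x.
  rewrite wmonoE // (cycle_mult_lifts trt wO); apply: eq_bigr => j _.
  rewrite /sexpo dE; case: ifP => // dm.
  have e0 : (0 < x.1.+1 %/ fingraph.order s (t j))%N.
    by rewrite divn_gt0 ?fingraph.order_gt0 // dvdn_leq.
  have lt : ((x.1.+1 %/ fingraph.order s (t j)).-1 < n)%N.
    by rewrite prednK // (leq_trans (leq_div _ _)).
  by rewrite /expo insubT /= bqE /f dE.
apply/forallP/eqP => [H|<- x]; last by rewrite E.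
by apply/ffunP => x; apply/val_inj => /=; rewrite -E; apply/eqP/H.
Qed.

(** Surjectivity and the monomial of [w] are traded for a sum over tuples of monomials; for each
    tuple [sum_labellings] applies with the sizes [mweight (b j)]. *)
Lemma sum_surjlab :
  \sum_(q : {ffun 'I_n -> K} | surjlab q) \sum_(w in lifts_along r s q | wmono w == a)
     \prod_j trm V (@rs r (nobj r n) (iter (d j) w) (fibre r q (t j)))
  = #|Wrn r n|%:R * \sum_(b : {ffun J -> Mono r n} | admissible b) \prod_j scoef (ch V) (b j).
Proof.
transitivity (\sum_(q : {ffun 'I_n -> K}) \sum_(w in lifts_along r s q)
   \sum_(b : {ffun J -> Mono r n} | admissible b)
     \prod_j monomial_trace (b j) (@rs r (nobj r n) (iter (d j) w) (fibre r q (t j)))).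
  rewrite big_mkcond; apply: eq_bigr => q _.
  transitivity (\sum_(w in lifts_along r s q) (surjlab q && (wmono w == a))%:R *
    \prod_j trm V (@rs r (nobj r n) (iter (d j) w) (fibre r q (t j)))); last first.
    by apply: eq_bigr => w wO; rewrite sum_monomial_trace.
  case: ifP => _ /=; last by rewrite big1 // => w _; rewrite mul0r.
  rewrite big_mkcondr; apply: eq_bigr => w _.
  by case: ifP; rewrite ?mul1r ?mul0r.
under eq_bigr do rewrite exchange_big /=.
rewrite exchange_big /= big_distrr /=; apply: eq_bigr => b /and3P[_ /eqP wb _].
have wbn j : (mweight (b j) <= n)%N.
  rewrite -[X in (_ <= X)%N]wb (bigD1 j) //=; apply: leq_trans (leq_addr _ _).
  by rewrite leq_pmull // dE fingraph.order_gt0.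
rewrite (eq_bigr _ (fun j _ => scoef_ch (wbn j))).
rewrite -(@sum_labellings _ _ n _ _ s t trt (fun j => mweight (b j))
   (fun j => monomial_trace (b j))) //.
- by apply: eq_bigr => q _; apply: eq_bigr => w _; apply: eq_bigr => j _; rewrite dE.
- by move=> j; apply: monomial_trace_conj.
- move=> j I f _ _; rewrite /monomial_trace; case: (#|I| =P _) => // _.
  by rewrite andbF mul0r eqxx.
- by rewrite -[RHS]wb; apply: eq_bigr => j _; rewrite dE.
Qed.

End Insert.
End MonomialPart.

(** * Labelled partitions *)

Lemma order_conj (K L : finType) (s : K -> K) (s' : L -> L) (f : K -> L) k :
  injective s -> injective s' -> injective f -> (forall x, f (s x) = s' (f x)) ->
  fingraph.order s' (f k) = fingraph.order s k.
Proof.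
move=> injs injs' injf fs.
have fi i : f (iter i s k) = iter i s' (f k) by elim: i => //= i <-.
have dvdE i : (fingraph.order s' (f k) %| i)%N = (fingraph.order s k %| i)%N.
  by rewrite -!iter_order_dvd // -fi (inj_eq injf).
by apply/eqP; rewrite eqn_dvd dvdE dvdnn -dvdE dvdnn.
Qed.

Lemma cycle_transversal_conj (K L J : finType) (s : K -> K) (s' : L -> L) (f : K -> L)
    (t : J -> K) : bijective f -> injective s' -> (forall x, f (s x) = s' (f x)) ->
  cycle_transversal s t -> cycle_transversal s' (f \o t).
Proof.
move=> [g fK gK] injs' fs [injs tc tu].
have fi i x : f (iter i s x) = iter i s' (f x) by elim: i => //= i <-.
split=> // [l|i j /= /iter_findex].
  have [j /iter_findex cj] := tc (g l); exists j.
  by rewrite -[l]gK -cj fi fconnect_iter.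
rewrite -fi => /(can_inj fK) e; apply: tu; rewrite -e; exact: fconnect_iter.
Qed.

Lemma is_hom_mu1 (I J : obj 1) (f : I -> J) :
  is_obj I -> is_obj J -> bijective f -> is_hom f.
Proof.
by move=> [a0 _ _] [b0 _ _] bf; split=> // x z; rewrite ord1 a0 b0.
Qed.

Section LabelledPartitions.
Variables (r n : nat).
Local Notation I := (nobj r n).
Implicit Types (P : {set {set I}}).

Definition fibres (K : finType) (q : {ffun 'I_n -> K}) : {set {set I}} :=
  [set fibre r q k | k in K].

Section Surjective.
Variables (K : finType) (q : {ffun 'I_n -> K}).
Hypothesis surj : surjlab q.

Lemma surjlab_ex k : exists i, q i = k.
Proof.
by have /card_gt0P[i] := forallP surj k; rewrite inE => /eqP; exists i.
Qed.

Lemma fibre_inj : injective (fibre r q).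
Proof.
move=> k l e; have [i qi] := surjlab_ex k.
have h : (0, i) \in fibre r q k by rewrite inE /= qi.
by move: h; rewrite e inE /= qi => /eqP.
Qed.

Lemma rpart_fibres : rpart (fibres q).
Proof.
have n0 : set0 \notin fibres q.
  apply/imsetP => -[k _ /setP e]; have [i qi] := surjlab_ex k.
  by have := e (0, i); rewrite !inE /= qi eqxx.
apply/and3P; split=> //; last by apply/forall_inP => B /imsetP[k _ ->]; apply: stable_fibre.
apply/and3P; split=> //.
  apply/eqP/setP => x; rewrite [RHS]inE; apply/bigcupP; exists (fibre r q (q x.2)).
    exact: imset_f.
  by rewrite inE.
apply/trivIsetP => A B /imsetP[k _ ->] /imsetP[l _ ->] nkl.
rewrite -setI_eq0; apply/eqP/setP => x; rewrite !inE.
by apply: contraNF nkl => /andP[/eqP-> /eqP->].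
Qed.

Lemma card_fibres : #|fibres q| = #|K|.
Proof. by rewrite card_imset //; apply: fibre_inj. Qed.

Lemma surjlab_card : (#|K| <= n)%N.
Proof.
have -> : #|K| = #|[set q i | i in 'I_n]|.
  rewrite -cardsT; apply: eq_card => k; rewrite inE; symmetry; apply/imsetP.
  by have [i <-] := surjlab_ex k; exists i.
by rewrite -[X in (_ <= X)%N](card_ord n) leq_imset_card.
Qed.

End Surjective.

Section CountLabels.
Variables (P : {set {set I}}) (K : finType).
Hypotheses (rP : rpart P) (cK : #|P| = #|K|).

Let partP : partition P [set: I]. Proof. by case/and3P: rP. Qed.
Let blkP i : pblock P (0, i) \in P.
Proof. by rewrite pblock_mem // (cover_partition partP) inE. Qed.
Let blkof i : blk P := exist _ (pblock P (0, i)) (blkP i).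

(** A stable block contains all the points over an index or none of them. *)
Let mem_blk (B : blk P) x : (x \in val B) = (blkof x.2 == B).
Proof.
have sP (A : {set I}) z z' i : A \in P -> (z, i) \in A -> (z', i) \in A.
  case/and3P: rP => _ _ /forall_inP sP AP zA.
  have /forall_inP/(_ _ zA)/forallP/(_ (z' - z)) := sP A AP.
  by rewrite /= addrC subrK.
rewrite -val_eqE /=; apply/idP/eqP => [xB|<-].
  apply: def_pblock; [exact: partition_trivIset partP | exact: valP |].
  by case: x xB => z i; apply: sP (valP B).
case: x => z i; apply: (sP _ 0); first exact: blkP.
by rewrite mem_pblock (cover_partition partP) inE.
Qed.

Let blk_ex (B : blk P) : exists i, blkof i = B.
Proof.
have /set0Pn[x xB] : val B != set0.
  by apply: contraTneq (valP B) => ->; case/and3P: rP.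
by exists x.2; apply/eqP; rewrite -mem_blk.
Qed.

(** Such a labelling is a bijection from the blocks to [K], composed with the map from an index to
    its block. *)
Lemma card_labels : #|[set q : {ffun 'I_n -> K} | surjlab q && (fibres q == P)]| = (#|K|)`!.
Proof.
have cB : #|{: blk P}| = #|K| by rewrite card_sig -cK; apply: eq_card.
pose lab (e : {ffun blk P -> K}) := [ffun i => e (blkof i)].
have lab_inj : injective lab.
  move=> e e' E; apply/ffunP => B; have [i <-] := blk_ex B.
  by have := congr1 (fun f : {ffun 'I_n -> K} => f i) E; rewrite !ffunE.
rewrite -ffactnn -{2}cB -card_inj_ffuns -(card_imset _ lab_inj); apply: eq_card => q.
rewrite inE; apply/andP/imsetP => [[sq /eqP fq]|[e]].
  have ex (B : blk P) : exists k, fibre r q k == val B.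
    have : val B \in fibres q by rewrite [X in _ \in pred_of_set X]fq; apply: valP.
    by case/imsetP=> k _ ->; exists k.
  pose e := [ffun B => xchoose (ex B)].
  have eE B : fibre r q (e B) = val B by rewrite ffunE; apply/eqP/(xchooseP (ex B)).
  exists e; first by rewrite inE; apply/injectiveP => B B' E; apply: val_inj; rewrite -!eE E.
  apply/ffunP => i; rewrite ffunE; have : (0, i) \in fibre r q (e (blkof i)).
    by rewrite eE mem_blk.
  by rewrite inE => /eqP.
rewrite inE => /injectiveP einj ->.
have [e' eK e'K] := inj_card_bij einj (eq_leq (esym cB)).
have fE k : fibre r (lab e) k = val (e' k).
  by apply/setP => x; rewrite inE ffunE mem_blk (can2_eq eK e'K).
split.
  apply/forallP => k; have [i bi] := blk_ex (e' k); apply/card_gt0P; exists i.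
  by rewrite inE ffunE bi e'K.
apply/eqP/setP => B; apply/imsetP/idP => [[k _ ->]|BP]; first by rewrite fE; apply: valP.
by exists (e (exist _ B BP)) => //; rewrite fE eK.
Qed.

End CountLabels.

(* A stable partition into [m] blocks is the set of fibres of exactly [m!]
   surjective labellings. *)
Lemma sum_partitions (C : numFieldType) (F : {set {set I}} -> C) :
  \sum_(P | rpart P) F P =
  \sum_(m < n.+1) (m`!)%:R^-1 *
     \sum_(q : {ffun 'I_n -> mu 1 * 'I_m} | surjlab q) F (fibres q).
Proof.
(* The labels form the carrier of [nobj 1 m], so that their permutations are elements of W(1, m). *)
have cardK m : #|{: mu 1 * 'I_m}| = m by rewrite card_prod !card_ord mul1n.
transitivity (\sum_(m < n.+1) \sum_(P | rpart P) (#|P| == m)%:R * F P).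
  rewrite exchange_big /=; apply: eq_bigr => P rP.
  have lt : (#|P| < n.+1)%N.
    (* The labellings of [P] number a factorial, so one exists, and its surjectivity bounds the
       number of blocks by [n]. *)
    have cK : #|P| = #|{: mu 1 * 'I_#|P|}| by rewrite cardK.
    have /card_gt0P[q] : (0 < #|[set q : {ffun 'I_n -> mu 1 * 'I_#|P|} |
        surjlab q && (fibres q == P)]|)%N by rewrite card_labels // fact_gt0.
    by rewrite inE ltnS => /andP[/surjlab_card]; rewrite cardK.
  rewrite (bigD1 (Ordinal lt)) //= eqxx mul1r big1 ?addr0 // => m nm.
  by rewrite -val_eqE eq_sym /= in nm; rewrite (negPf nm) mul0r.
apply: eq_bigr => m _.
rewrite (partition_big (@fibres _) (@rpart r I)) /=; last by move=> q; apply: rpart_fibres.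
rewrite big_distrr /=; apply: eq_bigr => P rP.
rewrite (eq_bigr (fun _ => F P)) => [|q /andP[_ /eqP -> //]].
rewrite -big_set sumr_const -[F P *+ _]mulr_natl mulrA; congr (_ * _).
have [e|ne] := eqVneq #|P| m.
  by rewrite card_labels ?cardK // mulVf // pnatr_eq0 -lt0n fact_gt0.
rewrite (_ : #|_| = 0%N) ?mulr0 //; apply: eq_card0 => q; rewrite inE.
by apply/negP => /andP[/(card_fibres (q := q)) + /eqP e]; rewrite e cardK => /eqP; apply/negP.
Qed.

End LabelledPartitions.

Lemma sum_tagged (C : nmodType) (I : finType) (T : I -> finType) (F : {i : I & T i} -> C) :
  \sum_p F p = \sum_i \sum_(x : T i) F (Tagged T x).
Proof.
rewrite (@sig_big_dep _ _ _ _ T predT (fun _ => predT) (fun i x => F (Tagged T x))) /=.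
by apply: eq_bigr => -[i x].
Qed.

(** * The trace on the composite module *)

Section BlockTrace.
Variables (C : numClosedFieldType) (r n : nat) (U : rmod C 1) (V : rmod C r).
Hypotheses (modU : is_mod U) (modV : is_mod V).
Variable w : {perm (mu r * 'I_n)}.
Hypothesis wW : w \in Wrn r n.
Local Notation I := (nobj r n).

(** Defined for every set of sets, with no proof of [rpart P] as argument, so that [P] can be
    replaced by [fibres r q]. *)
Definition block_trace (P : {set {set I}}) : C :=
  match @idP [forall B : blk P, [set w x | x in val B] \in P] with
  | ReflectT h => trm U (I := bobj P) (bmap h) *
      \sum_(v : {dffun forall B : blk P, bas V (sobj (val B))})
         \prod_(B : blk P) mor V (I := sobj (val B)) (J := @sobj r I [set w x | x in val B])
            (@restr I I w (val B)) (v B) (v (bmap h B))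
  | ReflectF _ => 0
  end.

Lemma trm_mcomp : trm (mcomp U V) (I := I) w = \sum_(P | rpart P) block_trace P.
Proof.
pose T (P : parts I) : finType :=
  (bas U (bobj (val P)) * {dffun forall B : blk (val P), bas V (sobj (val B))})%type.
transitivity (\sum_(P : parts I) \sum_(x : T P)
    cmor (I := I) (J := I) w (existT T P x) (existT T P x)).
  exact: (@sum_tagged C _ T (fun x => cmor (I := I) (J := I) w x x)).
rewrite [RHS](reindex_omap (val : parts I -> _) insub) /=; last first.
  by move=> P rP; rewrite insubT.
apply: eq_big => [[P rP]|P _] /=; first by rewrite rP insubT /= eqxx.
rewrite /block_trace; case: {-}_ / idP => h; last by rewrite big1 // => -[u v] _.
rewrite /trm big_distrlr /= pair_big /=.
by apply: eq_bigr => -[u v] _.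
Qed.

Lemma is_obj_bobj (T : finType) (P : {set {set T}}) : is_obj (bobj P).
Proof. by split=> // x z _; rewrite ord1. Qed.

Variables (m : nat) (q : {ffun 'I_n -> mu 1 * 'I_m}).
Hypothesis surj : surjlab q.
Local Notation K := (mu 1 * 'I_m)%type.

(** By surjectivity of [q] at most one [s] satisfies [q w = s q], and one exists exactly when [w]
    permutes the fibres; otherwise both sides vanish. The bijection [e] from labels to blocks
    conjugates [s] to the permutation of the blocks. *)
Lemma block_trace_fibres (J : {perm K} -> finType) (t : forall s, J s -> K) :
  (forall s : {perm K}, s \in Wrn 1 m -> cycle_transversal s (t s)) ->
  block_trace (fibres r q) =
  \sum_(s in Wrn 1 m | w \in lifts_along r s q) trm U (I := nobj 1 m) s *
    \prod_j trm V (@rs r I (iter (fingraph.order s (t s j)) w) (fibre r q (t s j))).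
Proof.
move=> trt; have finj : injective (fibre r q) by exact: fibre_inj.
have along (s : {perm K}) k : w \in lifts_along r s q ->
    [set w x | x in fibre r q k] = fibre r q (s k).
  case/lifts_alongP=> _ wq; apply/setP => y; apply/imsetP/idP => [[x + ->]|].
    by rewrite !inE wq => /eqP ->.
  rewrite inE => /eqP qy; exists ((w^-1)%g y); last by rewrite permKV.
  by rewrite inE -(inj_eq (@perm_inj _ s)) -wq permKV qy.
rewrite /block_trace; case: {-}_ / idP => h; last first.
  rewrite big_pred0 // => s; apply/negP => /andP[_ wO]; case: h; apply/forallP => B.
  have /imsetP[k _ ->] := valP B; rewrite (along _ _ wO); exact: imset_f.
have hB k : fibre r q k \in fibres r q by apply: imset_f.
pose e k : blk (fibres r q) := exist _ (fibre r q k) (hB k).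
have einj : injective e by move=> k l /(congr1 val) /finj.
have cB : #|{: blk (fibres r q)}| = #|{: K}|.
  by rewrite card_sig -(@card_fibres r n _ q surj); apply: eq_card.
have [e' eK e'K] := inj_card_bij einj (eq_leq cB).
have binj : injective (bmap h).
  move=> A B /(congr1 val) /= /(imset_inj (@perm_inj _ w)) E; exact: val_inj.
have sinj : injective (e' \o bmap h \o e).
  by move=> k l /= /(can_inj e'K) /binj /einj.
pose s := perm sinj.
have es k : e (s k) = bmap h (e k) by rewrite permE /= e'K.
have fs k : fibre r q (s k) = [set w x | x in fibre r q k].
  by have := congr1 val (es k).
have sW : s \in Wrn 1 m.
  apply/Wrn_hom/is_hom_mu1; [exact: is_obj_nobj | exact: is_obj_nobj |].
  exact: (Bijective (permK _) (permKV _)).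
have sO : w \in lifts_along r s q.
  apply/lifts_alongP; split=> // x; apply/eqP.
  have : w x \in fibre r q (s (q x.2)) by rewrite fs imset_f // inE.
  by rewrite inE.
rewrite (big_pred1 s) => [|s' /=]; last first.
  apply/andP/eqP => [[_ s'O]|->//]; apply/permP => k; apply: finj.
  by rewrite fs (along _ _ s'O).
congr (_ * _).
  symmetry; apply: (@trm_conj _ _ U modU (nobj 1 m) (bobj (fibres r q)) e s (bmap h)).
  - exact: is_obj_nobj.
  - exact: is_obj_bobj.
  - by apply: is_hom_mu1; [exact: is_obj_nobj | exact: is_obj_bobj | exists e'].
  - exact/Wrn_hom.
  - apply: is_hom_mu1; [exact: is_obj_bobj.. | exact: injF_bij].
  - exact: es.
have bije : bijective e by exists e'.
rewrite (trace_tensor modV (is_obj_nobj r n) _ _ (cycle_transversal_conj bije binj es (trt s sW))).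
- apply: eq_bigr => j _;
  by rewrite /= (order_conj _ (@perm_inj _ s) binj einj es).
- by move=> B /imsetP[k _ ->]; apply: stable_fibre.
- exact/Wrn_hom.
Qed.

End BlockTrace.

(** * Cycle types and the main theorem *)

Section CycleType.
Variables (m : nat) (s : {perm (mu 1 * 'I_m)}).
Hypothesis sW : s \in Wrn 1 m.
Local Notation K := (mu 1 * 'I_m)%type.

Let injs : injective s. Proof. exact: perm_inj. Qed.

Lemma order_wlen (k : K) : fingraph.order s k = wlen s k.2.
Proof.
case: k => z k; rewrite (ord1 z).
apply: (@order_conj 'I_m K (wsig s) s (fun i => (0, i))) => //.
- exact: wsig_inj.
- by move=> i j [].
- by move=> i; rewrite (WrnE _ _ sW); congr (_, _); rewrite [RHS]ord1.
Qed.

Lemma card_order_mul j :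
  (#|[pred k : K | froots s k & fingraph.order s k == j.+1]| * j.+1)%N =
  #|[set k | (wlen s k == j.+1) && (wtyp s k == 0)]|.
Proof.
pose A := [pred k : K | fingraph.order s k == j.+1].
have -> : #|[pred k : K | froots s k & fingraph.order s k == j.+1]| = fcard s A by [].
rewrite (@fcard_order_set _ _ injs j.+1); first last.
- apply: intro_closed => [k l|k l /eqP <-]; first exact: fconnect_sym.
  by rewrite !inE !order_wlen (Wrn_snd _ sW) // wlen_wsig.
- by apply/subsetP => k; rewrite !inE.
rewrite -(card_imset (mem [set k | _]) (f := fun i => (0, i) : K)); last by move=> i i' [].
apply: eq_card => -[z k]; rewrite (ord1 z) inE order_wlen /=; apply/idP/imsetP.
  by move=> e; exists k; rewrite // inE e /=; apply/eqP; rewrite ord1.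
by case=> i; rewrite inE => /andP[e _] [->].
Qed.

Lemma count_mparts (lam : Mono 1 m) v :
  count_mem v (mparts lam) = (\sum_(x : 'I_m * mu 1) (x.1.+1 == v) * lam x)%N.
Proof.
rewrite /mparts count_flatten -map_comp sumnE big_map big_enum /=.
by apply: eq_big => [x|x _] /=; rewrite ?inE // count_nseq.
Qed.

(** Multiplicities agree: an exponent of [wmono s] counts the cycles of the corresponding length,
    and each cycle has one root. *)
Lemma perm_mparts :
  perm_eq (mparts (wmono s)) [seq fingraph.order s k | k <- enum (froots s)].
Proof.
apply/allP => v _; apply/eqP; rewrite count_mparts count_map.
have -> : count (preim (fun k => fingraph.order s k) (pred1 v)) (enum (froots s)) =
    #|[pred k : K | froots s k & fingraph.order s k == v]|.
  rewrite cardE -size_filter; congr size; rewrite /enum_mem -filter_predI.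
  by apply: eq_filter => k; rewrite /= andbC.
case: v => [|j].
  rewrite big1 => [|x _] //; symmetry; apply: eq_card0 => k; rewrite !inE.
  by apply/negP => /andP[_ /eqP e]; have := fingraph.order_gt0 s k; rewrite e.
have [lt|ge] := ltnP j m.
  rewrite (bigD1 (Ordinal lt, 0)) //= eqxx mul1n big1 ?addn0; last first.
    move=> [i z]; rewrite (ord1 z) /= eqSS => ne.
    case: eqP => // e; case/negP: ne; apply/eqP; congr pair; exact: val_inj.
  apply/eqP; rewrite -(eqn_pmul2r (ltn0Sn j)) card_order_mul wmonoE //=.
  by rewrite cycle_multE.
rewrite big1 => [|[i z] _]; last first.
  rewrite /= eqSS; case: eqP => // e.
  by have := ltn_ord i; rewrite e ltnNge ge.
symmetry; apply: eq_card0 => k; rewrite !inE order_wlen.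
apply/negP => /andP[_ /eqP e]; have := wlen_le s k.2.
by rewrite e ltnNge ge.
Qed.

(** The permutation behind [perm_mparts] matches each position in the list of parts with the root of
    a cycle of that length. *)
Lemma mparts_transversal : exists t : 'I_(size (mparts (wmono s))) -> K,
  cycle_transversal s t /\
  forall j : 'I_(size (mparts (wmono s))), nth 0%N (mparts (wmono s)) j = fingraph.order s (t j).
Proof.
set l := mparts _; have /(perm_iotaP 0%N)[Is pI lE] := perm_mparts.
rewrite size_map -/l in pI lE.
have szI : size Is = size l by rewrite lE size_map.
have cA : size (enum (froots s)) = #|froots s| by rewrite cardE.
have ltI (j : 'I_(size l)) : (nth 0%N Is j < #|froots s|)%N.
  have : nth 0%N Is j \in Is by rewrite mem_nth // szI.
  by rewrite (perm_mem pI) mem_iota cA.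
pose t (j : 'I_(size l)) : K := enum_val (Ordinal (ltI j)).
have rt j : froots s (t j) by have := enum_valP (Ordinal (ltI j)).
have csym := fconnect_sym injs.
exists t; split; last first.
  move=> j; have tE k0 : t j = nth k0 (enum (froots s)) (nth 0%N Is j).
    exact: (enum_val_nth k0 (Ordinal (ltI j))).
  move: (t j) tE => k0 /(_ k0) ->.
  have := ltI j; rewrite -cA => lt; have jI : (j < size Is)%N by rewrite szI.
  rewrite -(nth_map k0 0%N (fun k => fingraph.order s k) lt) -(nth_map 0%N 0%N _ jI).
  by rewrite -lE.
split=> // [k|i j].
  have rk : froots s (froot s k) by apply: roots_root.
  pose p := enum_rank_in rk (froot s k).
  have pIs : (p : nat) \in Is by rewrite (perm_mem pI) mem_iota cA /= add0n ltn_ord.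
  have lt : (index (p : nat) Is < size l)%N by rewrite -szI index_mem.
  exists (Ordinal lt); have -> : t (Ordinal lt) = froot s k.
    rewrite -[RHS](enum_rankK_in rk rk); congr enum_val; apply: val_inj.
    by rewrite /= nth_index.
  by rewrite csym connect_root.
move/(fingraph.rootP csym); rewrite (eqP (rt i)) (eqP (rt j)) => /enum_val_inj/(congr1 val) /= /eqP.
rewrite nth_uniq ?szI //; first by move/eqP/val_inj.
by rewrite (perm_uniq pI) iota_uniq.
Qed.

End CycleType.

Lemma mem_Wrn_mu1 m (s : {perm (mu 1 * 'I_m)}) : s \in Wrn 1 m.
Proof.
apply/Wrn_hom/is_hom_mu1; try exact: is_obj_nobj.
exact: (Bijective (permK _) (permKV _)).
Qed.

Lemma ch_mcomp (C : numClosedFieldType) r (U : rmod C 1) (V : rmod C r) :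
  (0 < r)%N -> is_mod U -> is_mod V ->
  series_eq (ch (mcomp U V)) (pleth (ch U) (ch V)).
Proof.
move=> r0 modU modV n a wa.
transitivity (#|Wrn r n|%:R^-1 * \sum_(w in Wrn r n | wmono w == a)
    \sum_(m < n.+1) (m`!)%:R^-1 *
     \sum_(q : {ffun 'I_n -> mu 1 * 'I_m} | surjlab q) block_trace U V w (fibres r q)).
  rewrite /ch card_Wrn //; congr (_ * _); apply: eq_bigr => w /andP[wW _].
  by rewrite -/(trm (mcomp U V) (I := nobj r n) w) trm_mcomp sum_partitions.
rewrite exchange_big /= big_distrr /=; apply: eq_bigr => m _.
have [t tP] := fin_all_exists (fun s : {perm (mu 1 * 'I_m)} =>
  mparts_transversal (mem_Wrn_mu1 s)).
pose X (s : {perm (mu 1 * 'I_m)}) (q : {ffun 'I_n -> mu 1 * 'I_m}) (w : {perm (mu r * 'I_n)}) :=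
  \prod_(j < size (mparts (wmono s)))
     trm V (@rs r (nobj r n) (iter (nth 0%N (mparts (wmono s)) j) w) (fibre r q (t s j))).
pose PP (lam : Mono 1 m) :=
  \sum_(b : {ffun 'I_(size (mparts lam)) -> Mono r n} |
     admissible (fun j : 'I_(size (mparts lam)) => nth 0%N (mparts lam) j) a b) \prod_j scoef (ch V) (b j).
transitivity (m`!%:R^-1 * \sum_(s in Wrn 1 m) trm U (I := nobj 1 m) s * PP (wmono s)).
  rewrite -big_distrr /= mulrCA; congr (_ * _).
  (* The sum over [s] supplied by [block_trace_fibres] is moved outside, so that [(q, w)] ranges
     over all pairs with [q w = s q], as in [sum_surjlab]. *)
  transitivity (#|Wrn r n|%:R^-1 * \sum_(s in Wrn 1 m) \sum_(q | surjlab q)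
     \sum_(w in lifts_along r s q | wmono w == a) trm U (I := nobj 1 m) s * X s q w).
    congr (_ * _); rewrite exchange_big [RHS]exchange_big /=; apply: eq_bigr => q sq.
    transitivity (\sum_(w in Wrn r n | wmono w == a)
       \sum_(s in Wrn 1 m | w \in lifts_along r s q) trm U (I := nobj 1 m) s * X s q w).
      apply: eq_bigr => w /andP[wW _].
      rewrite (block_trace_fibres modU modV wW sq (t := t)) => [|s _]; last by case: (tP s).
      apply: eq_bigr => s _; congr (_ * _); apply: eq_bigr => j _.
      by have [_ ->] := tP s.
    rewrite (exchange_big_dep (mem (Wrn 1 m))) /= => [|w s _ /andP[] //].
    apply: eq_bigr => s sW; apply: eq_bigl => w; rewrite sW /=.
    have [wO|] := boolP (w \in lifts_along r s q); last by rewrite andbF.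
    by rewrite andbT; have /lifts_alongP[-> _] := wO.
  rewrite big_distrr /=; apply: eq_bigr => s _.
  under eq_bigr do rewrite -big_distrr /=.
  rewrite -big_distrr /= mulrCA; congr (_ * _); have [trt dE] := tP s.
  by rewrite /X (sum_surjlab r0 modV trt dE) mulrA mulVf ?mul1r // card_Wrn_neq0.
(* [PP] depends on [s] only through its cycle type; grouping by it turns the traces of [U] into
   coefficients of ch(U). *)
rewrite (partition_big (@wmono 1 m) (fun lam => mweight lam == m)) /=; last first.
  by move=> s sW; rewrite mweight_wmono.
rewrite big_distrr /=; apply: eq_bigr => lam _.
rewrite (eq_bigr (fun s : {perm (mu 1 * 'I_m)} => trm U (I := nobj 1 m) s * PP lam)); last first.
  by move=> s /andP[_ /eqP ->].
by rewrite -big_distrl /= mulrA /ch exp1n mul1n.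
Qed.

Lemma is_mod_lin (C : numClosedFieldType) r (A : rsp r) : is_sp A -> is_mod (lin C A).
Proof.
case=> AF [A1 AM]; split=> [I oI x y|I J K f g oI oJ oK hf hg x z] /=; first by rewrite A1.
have [y [xy yu]] := AF I J f oI oJ hf x.
rewrite AM // (bigD1 y) //= xy mul1r big1 ?addr0 => [|y' ny]; last first.
  case: (boolP (spm A f x y')) => [/yu e|_]; last by rewrite mul0r.
  by rewrite e eqxx in ny.
congr (nat_of_bool _)%:R; apply/existsP/idP => [[y' /andP[/yu <- //]]|yz].
by exists y; rewrite xy.
Qed.

(** The two bases agree by conversion, and a product of entries 0 or 1 is the indicator of a
    conjunction. *)
Lemma mor_spcomp (C : numClosedFieldType) r (A : rsp 1) (B : rsp r) (I J : obj r)
    (f : I -> J) x y :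
  mor (lin C (spcomp A B)) f x y = mor (mcomp (lin C A) (lin C B)) f x y.
Proof.
case: x y => P [u v] [Q [u' v']] /=; case: {-}_ / idP => // h.
rewrite -mulnb natrM; congr (_ * _).
case: forallP => [H|/forallP]; first by rewrite big1 // => Bk _; rewrite H.
rewrite negb_forall => /existsP[Bk /negPf nB].
by rewrite (bigD1 Bk) //= nB mul0r.
Qed.

Theorem theorem4p6 (C : numClosedFieldType) (r : nat) : (0 < r)%N ->
  (forall (U : rmod C 1) (V : rmod C r),
     is_mod U -> is_mod V ->
     (forall I : obj r, is_obj I -> #|I| = 0%N -> #|bas V I| = 0%N) ->
     series_eq (ch (mcomp U V)) (pleth (ch U) (ch V))) /\
  (forall (A : rsp 1) (B : rsp r),
     is_sp A -> is_sp B ->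
     (forall I : obj r, is_obj I -> #|I| = 0%N -> #|spo B I| = 0%N) ->
     series_eq (Zc C (spcomp A B)) (pleth (Zc C A) (Zc C B))).
Proof.
move=> r0; split=> [U V modU modV _ | A B spA spB _ n a wa]; first exact: ch_mcomp.
rewrite /Zc -(ch_mcomp r0 (is_mod_lin C spA) (is_mod_lin C spB) wa).
congr (_ * _); apply: eq_bigr => w _; apply: eq_bigr => x _; exact: mor_spcomp.
Qed.
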